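(* Let $h>0$ and $\beta>0$. For all $j\in\mathbf E$, the first effective catastrophe time $C_{j0}$ satisfies $$E(C_{j0})=\frac1\beta+\frac{\tilde r_{j0}(\beta)}{1-\beta\tilde r_{00}(\beta)},$$ $$\mathrm{Var}(C_{j0})=\frac{1}{\beta^2}\bigg\{1-\frac{\beta^2\tilde r_{j0}^2(\beta)}{[1-\beta\tilde r_{00}(\beta)]^2}-\frac{2\beta^2}{1-\beta\tilde r_{00}(\beta)}\frac{d}{d\beta}\tilde r_{j0}(\beta)-\frac{2\beta^3\tilde r_{j0}(\beta)}{[1-\beta\tilde r_{00}(\beta)]^2}\frac{d}{d\beta}\tilde r_{00}(\beta)\bigg\}.$$
   Context: Let $\mathbf E=\{0,1,2,\dots\}$ and let $c\ge 1$ be an integer (the number of servers). Let $(b_j)_{j\ge0}$ be reals with $b_j\ge 0$ for $j\ne 1$, $0<-b_1=\sum_{j\ne1}b_j<\infty$, $b_0>0$ and $\sum_{j\ge2}b_j>0$. Let $\beta>0$ and $h_j\ge0$ ($j\ge1$) with $0<h:=\sum_{j\ge1}h_j<\infty$. The queue with resurrection (no catastrophes) has conservative bounded $q$-matrix $\tilde Q$ on $\mathbf E$ (not depending on $\beta$): for $i\ge1$, $\tilde q_{i,i-1}=\min(i,c)b_0$, $\tilde q_{ii}=b_1-[\min(i,c)-1]b_0$, $\tilde q_{ij}=b_{j-i+1}$ ($j\ge i+1$); $\tilde q_{00}=-h$, $\tilde q_{0j}=h_j$ ($j\ge1$); other entries $0$. Its transition function is $(\tilde p_{ij}(t))$ and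 $\tilde r_{ij}(\lambda)=\int_0^\infty e^{-\lambda t}\tilde p_{ij}(t)\,dt$. The queue with resurrection and catastrophes moves as $\tilde Q$ and in addition jumps from each state $i\ge1$ to $0$ at rate $\beta$ (a catastrophe; it is ''effective'' since the state is positive). $C_{j0}$ is the first occurrence time of an effective catastrophe when starting from $j$. Formally, let $\{M_t\}$ be the Markov chain on $\mathbf S=\{-1,0,1,\dots\}$ with $q$-matrix whose off-diagonal entries among states of $\mathbf E$ are those of $\tilde Q$, with additional jumps from each $i\ge1$ to $-1$ at rate $\beta$, and $-1$ absorbing (conservative); then $C_{j0}$ is the hitting time of $-1$ by $M$ with $M_0=j$. *)

(* Defs.v *)
From mathcomp Require Export all_boot all_order all_algebra.
From mathcomp Require Export all_classical all_reals all_analysis.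
Export Order.TTheory GRing.Theory Num.Theory.
Export numFieldNormedType.Exports.

Set Implicit Arguments.
Unset Strict Implicit.
Unset Printing Implicit Defensive.

Local Open Scope classical_set_scope.
Local Open Scope ring_scope.

(* Times range over R; the values of p at negative times are irrelevant. *)
Definition transition_function (R : realType) (S : countType)
    (p : R -> S -> S -> R) : Prop :=
  [/\ (forall t i j, 0 <= t -> 0 <= p t i j),
      (forall t i, 0 <= t -> (\esum_(j in [set: S]) (p t i j)%:E <= 1%:E)%E),
      (forall i j, p 0 i j = (i == j)%:R),
      (forall i j, p t i j @[t --> 0^'+] --> ((i == j)%:R : R)) &
      (forall s t i k, 0 <= s -> 0 <= t ->
        (p (s + t) i k)%:E
          = \esum_(j in [set: S]) (p s i j * p t j k)%:E)].

(* The q-matrix of p is its entrywise right derivative at time 0.  When the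
   matrix q is conservative and bounded, it is the q-matrix of exactly one
   transition function. *)
Definition has_q_matrix (R : realType) (S : countType)
    (p : R -> S -> S -> R) (q : S -> S -> R) : Prop :=
  forall i j, (p t i j - (i == j)%:R) / t @[t --> 0^'+] --> q i j.

Definition transition_function_of (R : realType) (S : countType)
    (q : S -> S -> R) (p : R -> S -> S -> R) : Prop :=
  transition_function p /\ has_q_matrix p q.

Definition laplace (R : realType) (S : countType)
    (p : R -> S -> S -> R) (i j : S) (lambda : R) : R :=
  Rintegral lebesgue_measure `[0, +oo[
    (fun t => expR (- lambda * t) * p t i j).

(* The off-diagonal entries are those of r; the diagonal ones are minus the sum
   of the other entries of the row. *)
Definition conservative_q_matrix (R : realType) (S : countType)
    (r : S -> S -> R) (i j : S) : R :=
  if i == j then - fine (\esum_(k in [set k | k != i]) (r i k)%:E)%E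
  else r i j.

(* Neither b (j - i).+1 for j <= i nor h_ 0 is ever used. *)
Definition q_resurrection (R : realType) (c : nat) (b h_ : nat -> R) (h : R)
    (i j : nat) : R :=
  if i == 0%N then (if j == 0%N then - h else h_ j)
  else if j.+1 == i then (minn i c)%:R * b 0%N
  else if j == i then b 1%N - ((minn i c)%:R - 1) * b 0%N
  else if (i < j)%N then b (j - i).+1
  else 0.

(* The state space {-1, 0, 1, ...} is encoded as option nat, with None for -1. *)
Definition rate_catastrophe (R : realType) (c : nat) (b h_ : nat -> R)
    (h beta : R) (i j : option nat) : R :=
  match i, j with
  | Some i, Some j => q_resurrection c b h_ h i j
  | Some i, None => if (0 < i)%N then beta else 0
  | None, _ => 0
  end.

Definition q_catastrophe (R : realType) (c : nat) (b h_ : nat -> R)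
    (h beta : R) : option nat -> option nat -> R :=
  conservative_q_matrix (rate_catastrophe c b h_ h beta).

(* Paths are right-continuous for the discrete topology of S.  The last two
   clauses determine the finite-dimensional distributions of M. *)
Definition markov_chain (R : realType) (d : measure_display)
    (Omega : measurableType d) (P : probability Omega R) (S : countType)
    (q : S -> S -> R) (M : R -> Omega -> S) (x0 : S) : Prop :=
  exists p : R -> S -> S -> R,
  [/\ transition_function_of q p,
      (forall t i, 0 <= t -> measurable [set w | M t w = i]),
      (forall w t, 0 <= t -> \forall s \near t^'+, M s w = M t w),
      P [set w | M 0 w = x0] = 1%:E &
      (forall (n : nat) (t : nat -> R) (x : nat -> S),
        0 <= t 0%N -> (forall k, t k <= t k.+1) ->
        P [set w | forall k, (k <= n.+1)%N -> M (t k) w = x k]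
        = (P [set w | forall k, (k <= n)%N -> M (t k) w = x k]
           * (p (t n.+1 - t n) (x n) (x n.+1))%:E)%E)].

(* It is +oo on the paths that never visit i. *)
Definition hitting_time (R : realType) (Omega : Type) (S : Type)
    (M : R -> Omega -> S) (i : S) (w : Omega) : \bar R :=
  ereal_inf [set t%:E | t in [set t : R | 0 <= t /\ M t w = i]].

(* The library's expectation and variance are for real-valued functions only,
   whereas a hitting time may be infinite. *)
Definition emean (R : realType) (d : measure_display)
    (Omega : measurableType d) (P : probability Omega R)
    (X : Omega -> \bar R) : \bar R :=
  (\int[P]_w X w)%E.

Definition evariance (R : realType) (d : measure_display)
    (Omega : measurableType d) (P : probability Omega R)
    (X : Omega -> \bar R) : \bar R :=
  (\int[P]_w ((X w - emean P X) * (X w - emean P X)))%E.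

(* Main.v *)
Require Import Defs.
From mathcomp Require Import measurable_realfun.
From mathcomp Require Import ring lra.

(** Write [Q] for the rates of the queue with resurrection, [r_i(mu)] for the
    Laplace transform at [mu] of its transition probability from [i] to [0], and
    [y_i(t)] for the probability that the chain with catastrophes, started at
    [i], has not been absorbed by time [t].  Catastrophes strike at rate [beta]
    in every state but [0], so they are a killing at rate [beta] everywhere,
    compensated by a source of strength [beta] in [0].  For the Laplace
    transform [u_i(l)] of [y_i] and [mu = l + beta], the backward equation says
      [(mu - Q) u = 1 + beta u_0 e_0],
    while [(mu - Q) 1 = mu] because [Q] is conservative, and
    [(mu - Q) r_.(mu) = e_0].  The rates are bounded, so bounded solutions are
    unique ([bounded_solution_unique]), and
      [u_i(l) = 1 / mu + beta u_0(l) r_i(mu)].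
    Solving at [i = 0] gives [u_j(l) = H(l + beta)] with
      [H(mu) = (1 + beta r_j(mu) / (1 - beta r_0(mu))) / mu]
    ([survival_laplaceE]).  Letting [l] tend to [0], the mean absorption time is
    [H(beta)] and the second moment is [- 2 H'(beta)]; expanding them gives the
    two formulas.

    The definition of the [q]-matrix only gives the derivative of each entry at
    time [0].  Along a row of a conservative matrix this entrywise convergence
    improves to convergence in [l^1], as in Scheffe's lemma
    ([scheffe_series]).  That suffices to pass to the limit [s -> 0] in the
    Chapman-Kolmogorov equation between the times [s] and [s + t], once it has
    been integrated against [exp (- l t)] ([backward_laplace]); only derivatives at
    time [0] occur.

    On the probability side, paths are right-continuous and the state [None] is
    absorbing, so up to a null set absorption before [t] means presence in [None]
    at a rational time before [t].  Hence the hitting time [C] is measurable and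
    [P (t <= C) = y_j(t)] ([hitting_time_tail]); the moments of [C] become
    integrals of [y_j] by Tonelli's theorem ([hitting_time_tonelli]). *)

Set Implicit Arguments.
Unset Strict Implicit.
Unset Printing Implicit Defensive.
Local Open Scope classical_set_scope.
Local Open Scope ring_scope.

(** * Series of kernels and bounded solutions *)

(** Each partial sum on the left is a limit of partial sums of the series bounded
    by [c s]. *)
Lemma fatou_series (R : realType) (P : pred nat) (K : R -> nat -> R)
    (c : R -> R) (q w : nat -> R) (L : R) :
    (forall k, P k -> 0 <= w k) ->
    (forall s k, 0 < s -> P k -> 0 <= K s k) ->
    (forall k, P k -> K s k @[s --> 0^'+] --> q k) ->
    (forall s, 0 < s -> (\sum_(k <oo | P k) (K s k * w k)%:E <= (c s)%:E)%E) ->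
    c s @[s --> 0^'+] --> L ->
  (\sum_(k <oo | P k) (q k * w k)%:E <= L%:E)%E.
Proof.
move=> w0 K0 Kq Kc cL.
have q0 k : P k -> 0 <= q k.
  move=> Pk; apply: (cvgr_to_ge (Kq k Pk)).
  near=> s; apply: K0 => //; near: s; exact: nbhs_right_gt.
apply: lime_le.
  by apply: is_cvg_nneseries => k _ Pk; rewrite lee_fin mulr_ge0 ?q0 ?w0.
near=> N; rewrite sumEFin lee_fin.
apply: (@ler_cvg_to _ (at_right (0 : R)) _ _
  (fun s => \sum_(0 <= k < N | P k) K s k * w k) c) => //.
  elim: (index_iota 0 N) => [|k r IHr].
    under eq_cvg do rewrite big_nil.
    by rewrite big_nil; exact: cvg_cst.
  under eq_cvg do rewrite big_cons.
  rewrite big_cons; case: ifPn => // Pk.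
  by apply: cvgD => //; apply: cvgMl; exact: Kq.
near=> s; rewrite -lee_fin -sumEFin; apply: le_trans (Kc s _) => //.
apply: nneseries_lim_ge => k _ Pk; rewrite lee_fin mulr_ge0 ?w0 ?K0 //.
Unshelve. all: by end_near. Qed.

(** Fatou's inequality applied to [v] and to [B - v]: as the total mass [T s]
    converges to the mass [Q] of the limit, no mass escapes to infinity and the
    two inequalities force an equality. *)
Lemma scheffe_series (R : realType) (P : pred nat) (K : R -> nat -> R)
    (T c : R -> R) (q v : nat -> R) (Q B L : R) :
    (forall k, P k -> 0 <= v k <= B) -> 0 <= B ->
    (forall s k, 0 < s -> P k -> 0 <= K s k) ->
    (forall k, P k -> K s k @[s --> 0^'+] --> q k) ->
    (\sum_(k <oo | P k) (q k)%:E = Q%:E)%E ->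
    (forall s, 0 < s -> (\sum_(k <oo | P k) (K s k)%:E <= (T s)%:E)%E) ->
    T s @[s --> 0^'+] --> Q ->
    (forall s, 0 < s -> (\sum_(k <oo | P k) (K s k * v k)%:E = (c s)%:E)%E) ->
    c s @[s --> 0^'+] --> L ->
  (\sum_(k <oo | P k) (q k * v k)%:E = L%:E)%E.
Proof.
move=> v01 B0 K0 Kq qQ KT TQ Kc cL.
have v0 k : P k -> 0 <= v k by move=> /v01/andP[].
have v1 k : P k -> 0 <= B - v k by move=> /v01/andP[_]; rewrite subr_ge0.
have q0 k : P k -> 0 <= q k.
  move=> Pk; apply: (cvgr_to_ge (Kq k Pk)).
  near=> s; apply: K0 => //; near: s; exact: nbhs_right_gt.
have le1 : (\sum_(k <oo | P k) (q k * v k)%:E <= L%:E)%E.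
  apply: (@fatou_series _ _ K c) => // s s0.
  by rewrite Kc.
have le2 : (\sum_(k <oo | P k) (q k * (B - v k))%:E <= (B * Q - L)%:E)%E.
  apply: (@fatou_series _ _ K (fun s => B * T s - c s)) => // [s s0|].
    rewrite EFinB leeBrDr // -Kc // -nneseriesD => [|k _ Pk|k _ Pk].
    - rewrite EFinM; apply: (@le_trans _ _ (B%:E * \sum_(k <oo | P k) (K s k)%:E)%E).
        rewrite -nneseriesZl => [|k Pk]; last by rewrite lee_fin K0.
        rewrite le_eqVlt; apply/orP; left; apply/eqP; apply: eq_eseriesr => k Pk.
        by rewrite -EFinD -EFinM; congr EFin; ring.
      by apply: lee_wpmul2l; rewrite ?lee_fin // KT.
    - by rewrite lee_fin mulr_ge0 ?K0 ?v1.
    - by rewrite lee_fin mulr_ge0 ?K0 ?v0.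
  by apply: cvgB => //; apply: cvgMr.
apply/eqP; rewrite eq_le le1 /=.
have : (\sum_(k <oo | P k) (q k * v k)%:E + \sum_(k <oo | P k) (q k * (B - v k))%:E
   = (B * Q)%:E)%E.
  rewrite -nneseriesD => [|k _ Pk|k _ Pk]; rewrite ?lee_fin ?mulr_ge0 ?q0 ?v0 ?v1 //.
  rewrite EFinM -qQ -nneseriesZl => [|k Pk]; last by rewrite lee_fin q0.
  apply: eq_eseriesr => k Pk.
  by rewrite -EFinD -EFinM; congr EFin; ring.
move=> eqB.
rewrite -(leeD2rE (x := (B * Q - L)%:E)) // -EFinD addrCA subrr addr0 -eqB.
exact: leeD2l.
Unshelve. all: by end_near. Qed.

(** The equations for [u] and [z] say that [u - z] is the image of itself under an
    operator of norm at most [Lam / (mu + Lam) < 1] on bounded sequences, because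
    [Qs i / (mu + Qs i)] is at most that ratio.  The sign conditions allow all
    series to be nonnegative ones. *)
Lemma bounded_solution_unique (R : realType) (q : nat -> nat -> R) (Qs g u z : nat -> R)
    (mu Lam B : R) :
    0 < mu ->
    (forall i k, k != i -> 0 <= q i k) ->
    (forall i, (\sum_(k <oo | k != i) (q i k)%:E = (Qs i)%:E)%E) ->
    (forall i, Qs i <= Lam) ->
    (forall i, 0 <= u i <= B) -> (forall i, 0 <= z i <= B) ->
    (forall i, (\sum_(k <oo | k != i) (q i k * u k)%:E
                = ((mu + Qs i) * u i - g i)%:E)%E) ->
    (forall i, (\sum_(k <oo | k != i) (q i k * z k)%:E
                = ((mu + Qs i) * z i - g i)%:E)%E) ->
  u =1 z.
Proof.
move=> mu0 q0 qQ QL u0B z0B.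
have u0 i : 0 <= u i by case/andP: (u0B i).
have z0 i : 0 <= z i by case/andP: (z0B i).
have uB i : u i <= B by case/andP: (u0B i).
have zB i : z i <= B by case/andP: (z0B i).
have Q0 i : 0 <= Qs i.
  rewrite -lee_fin -qQ; apply: nneseries_ge0 => k _ ki.
  by rewrite lee_fin q0.
have B0 : 0 <= B by exact: le_trans (u0 0%N) (uB 0%N).
have La0 : 0 <= Lam := le_trans (Q0 0%N) (QL 0%N).
pose rho := Lam / (mu + Lam).
have mL : 0 < mu + Lam by rewrite ltr_pwDl.
have rho0 : 0 <= rho by rewrite divr_ge0 // ltW.
have rho1 : rho < 1 by rewrite ltr_pdivrMr // mul1r ltrDr.
(* One application of the contraction; [u <= z] and [z <= u] are both instances. *)
have step (a b : nat -> R) (M : R) i :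
    0 <= M -> (forall k, 0 <= a k) -> (forall k, 0 <= b k) ->
    (\sum_(k <oo | k != i) (q i k * a k)%:E = ((mu + Qs i) * a i - g i)%:E)%E ->
    (\sum_(k <oo | k != i) (q i k * b k)%:E = ((mu + Qs i) * b i - g i)%:E)%E ->
    (forall k, a k <= b k + M) -> a i <= b i + rho * M.
  move=> M0 a0 b0 ea eb ab.
  have : ((mu + Qs i) * a i - g i <= (mu + Qs i) * b i - g i + M * Qs i).
    rewrite -lee_fin [leRHS]EFinD (EFinM M) -qQ -ea -eb -nneseriesZl; last first.
      by move=> k ki; rewrite lee_fin q0.
    rewrite -nneseriesD => [|k _ ki|k _ ki]; rewrite ?lee_fin ?mulr_ge0 ?q0 //.
    apply: lee_nneseries => [k _ ki|k ki]; first by rewrite lee_fin mulr_ge0 ?q0.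
    by rewrite -EFinM -EFinD lee_fin [M * _]mulrC -mulrDr ler_wpM2l ?q0.
  have mQ : 0 < mu + Qs i by rewrite ltr_pwDl.
  have rQ : Qs i <= (mu + Qs i) * rho.
    rewrite /rho mulrA ler_pdivlMr //.
    by rewrite mulrDr mulrDl [Qs i * mu]mulrC lerD2r ler_wpM2l // ltW.
  have rM : M * Qs i <= (mu + Qs i) * (rho * M).
    by rewrite mulrA [M * _]mulrC ler_wpM2r.
  move=> h; rewrite -(ler_pM2l mQ) mulrDr.
  lra.
move=> eu ez i.
have main n : (forall k, u k <= z k + rho ^+ n * B) /\
    (forall k, z k <= u k + rho ^+ n * B).
  elim: n => [|n [IH1 IH2]].
    rewrite expr0 mul1r; split=> k.
      by apply: (le_trans (uB k)); rewrite lerDr.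
    by apply: (le_trans (zB k)); rewrite lerDr.
  by split=> k; rewrite exprS -mulrA; apply: step => //; rewrite mulr_ge0 // exprn_ge0.
have cv : rho ^+ n * B @[n --> \oo] --> 0.
  have : rho ^+ n * B @[n --> \oo] --> 0 * B.
    by apply: cvgMl; apply: cvg_expr; rewrite ger0_norm.
  by rewrite mul0r.
apply/eqP; rewrite eq_le; apply/andP; split.
- rewrite -[leRHS]addr0.
  apply: (@cvgr_to_ge _ \oo _ _ (fun n => z i + rho ^+ n * B)).
    by apply: cvgD => //; exact: cvg_cst.
  by apply: nearW => n; case: (main n).
- rewrite -[leRHS]addr0.
  apply: (@cvgr_to_ge _ \oo _ _ (fun n => u i + rho ^+ n * B)).
    by apply: cvgD => //; exact: cvg_cst.
  by apply: nearW => n; case: (main n).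
Qed.

(** * Laplace transforms of bounded continuous functions *)

(** [laplace p i j] is convertible to [laplace_fun (fun t => p t i j)]; the
    transform is also needed for functions that are not transition
    probabilities. *)
Definition laplace_fun (R : realType) (y : R -> R) (lambda : R) : R :=
  Rintegral lebesgue_measure `[0, +oo[ (fun t => expR (- lambda * t) * y t).

Lemma continuous_expR_lin (R : realType) (a : R) :
  continuous (fun t : R => expR (a * t)).
Proof.
move=> x; apply: continuous_comp; last exact: continuous_expR.
exact: mulrl_continuous.
Qed.

Lemma integral_exp (R : realType) (lambda : R) : 0 < lambda ->
  (\int[lebesgue_measure]_(t in `[0%R, +oo[) (expR (- lambda * t))%:E
    = (lambda^-1)%:E)%E.
Proof.
move=> l0.
have : (\int[lebesgue_measure]_(t in `[0%R, +oo[)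
    (lambda * expR (- lambda * t))%:E = 1%:E)%E.
  rewrite integral_mkcond -(integral_exponential_pdf l0).
  by apply: eq_integral => t _; rewrite /exponential_pdf !patchE; case: ifP.
under eq_integral do rewrite EFinM.
rewrite ge0_integralZl //=; last 2 first.
- apply/measurable_EFinP; apply: measurable_funTS.
  exact: (continuous_measurable_fun (@continuous_expR_lin _ _)).
- by rewrite lee_fin ltW.
set I := (\int[_]_(_ in _) _)%E => h.
have : (lambda^-1%:E * (lambda%:E * I) = lambda^-1%:E * 1%:E)%E by rewrite h.
by rewrite muleA -!EFinM mulVf ?gt_eqF // mul1e mulr1.
Qed.

Section laplace_fun_bounded.
Variables (R : realType) (y : R -> R).
Hypothesis y_cont : continuous y.
Hypothesis y01 : forall t, 0 <= t -> 0 <= y t <= 1.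

Let y0 t : 0 <= t -> 0 <= y t. Proof. by move=> /y01/andP[]. Qed.
Let y1 t : 0 <= t -> y t <= 1. Proof. by move=> /y01/andP[]. Qed.

Lemma continuous_expM (lambda : R) : continuous (fun t => expR (- lambda * t) * y t).
Proof.
move=> t; apply: cvgM; [exact: continuous_expR_lin | exact: y_cont].
Qed.

Lemma measurable_expM (lambda : R) (D : set R) :
  measurable_fun D (fun t => expR (- lambda * t) * y t).
Proof.
apply: measurable_funTS; apply: continuous_measurable_fun; exact: continuous_expM.
Qed.

Lemma integral_expM_le (lambda : R) : 0 < lambda ->
  (\int[lebesgue_measure]_(t in `[0%R, +oo[) (expR (- lambda * t) * y t)%:E
    <= (lambda^-1)%:E)%E.
Proof.
move=> l0; rewrite -(integral_exp l0).
apply: ge0_le_integral => //.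
- by move=> t /=; rewrite in_itv /= andbT => t0; rewrite lee_fin mulr_ge0 ?expR_ge0 ?y0.
- by apply/measurable_EFinP; exact: measurable_expM.
- apply/measurable_EFinP; apply: measurable_funTS.
  exact: (continuous_measurable_fun (@continuous_expR_lin _ _)).
- move=> t /=; rewrite in_itv /= andbT => t0.
  by rewrite lee_fin ler_piMr ?expR_ge0 ?y1.
Qed.

Lemma integral_expM_ge0 (lambda : R) :
  (0 <= \int[lebesgue_measure]_(t in `[0%R, +oo[) (expR (- lambda * t) * y t)%:E)%E.
Proof.
apply: integral_ge0 => t /=; rewrite in_itv /= andbT => t0.
by rewrite lee_fin mulr_ge0 ?expR_ge0 ?y0.
Qed.

Lemma laplace_funE (lambda : R) : 0 < lambda ->
  (\int[lebesgue_measure]_(t in `[0%R, +oo[) (expR (- lambda * t) * y t)%:E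
    = (laplace_fun y lambda)%:E)%E.
Proof.
move=> l0; rewrite /laplace_fun /Rintegral fineK // ge0_fin_numE ?integral_expM_ge0 //.
exact: le_lt_trans (integral_expM_le l0) (ltry _).
Qed.

Lemma integrable_expM (lambda : R) : 0 < lambda ->
  lebesgue_measure.-integrable `[0, +oo[ (EFin \o (fun t => expR (- lambda * t) * y t)).
Proof.
move=> l0; apply/integrableP; split.
  by apply/measurable_EFinP; exact: measurable_expM.
apply: le_lt_trans (ltry lambda^-1); apply: le_trans (integral_expM_le l0).
apply: ge0_le_integral => //.
- by apply/measurable_EFinP/measurableT_comp => //; exact: measurable_expM.
- by apply/measurable_EFinP; exact: measurable_expM.
- move=> t /=; rewrite in_itv /= andbT => t0.
  by rewrite lee_fin ger0_norm // mulr_ge0 ?expR_ge0 ?y0.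
Qed.

Lemma laplace_fun_ge0 (lambda : R) : 0 <= laplace_fun y lambda.
Proof. by rewrite fine_ge0 // integral_expM_ge0. Qed.

Lemma laplace_fun_le (lambda : R) : 0 < lambda -> laplace_fun y lambda <= lambda^-1.
Proof. by move=> l0; rewrite -lee_fin -laplace_funE // integral_expM_le. Qed.

(** The substitution [u = s + t], with the integral over [0, +oo[ split at [s]. *)
Lemma laplace_fun_shift (lambda s : R) : 0 < lambda -> 0 < s ->
  (\int[lebesgue_measure]_(t in `[0%R, +oo[) (expR (- lambda * t) * y (s + t))%:E
   = (expR (lambda * s) * (laplace_fun y lambda
       - Rintegral lebesgue_measure `[0, s] (fun t => expR (- lambda * t) * y t)))%:E)%E.
Proof.
move=> l0 s0.
pose G (u : R) := expR (lambda * s) * (expR (- lambda * u) * y u).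
pose F (x : R) := x + s.
have F0 : F 0 = s by rewrite /F add0r.
have DF (x : R) : is_derive x (1 : R) F (1 : R).
  by apply: is_derive_eq; rewrite addr0.
have dF : derive1 F = cst 1.
  by apply/funext => x; rewrite derive1E; apply: derive_val.
have cF : continuous F.
  by move=> x; apply: cvgD => //; exact: cvg_cst.
have cG : continuous G.
  by move=> x; apply: cvgMr; exact: continuous_expM.
transitivity (\int[lebesgue_measure]_(t in `[0%R, +oo[) (((G \o F) * derive1 F) t)%:E)%E.
  apply: eq_integral => t _; congr EFin; rewrite dF /G /F /= fctE /= mulr1 mulrA -expRD.
  by rewrite [t + s]addrC; congr (expR _ * _); ring.
rewrite -(@increasing_ge0_integration_by_substitutiony _ F G 0) ?F0; first last.
- move=> u; rewrite in_itv /= andbT => su.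
  by rewrite /G !mulr_ge0 ?expR_ge0 // y0 // ltW // (lt_trans s0).
- exact: continuous_subspaceT.
- by rewrite /F; apply: cvg_addrr.
- by split; [move=> x _; exact: ex_derive|exact/cvg_at_right_filter/cF].
- by rewrite dF; exact: is_cvg_cst.
- by rewrite dF; exact: is_cvg_cst.
- by rewrite dF => x _; exact: cst_continuous.
- by move=> a b _ _ ab; rewrite /F ltrD2r.
rewrite /G; under eq_integral do rewrite EFinM.
have iy := integrable_expM l0.
have ssub : (`[s, +oo[%classic : set R) `<=` `[0, +oo[.
  by move=> u /=; rewrite !in_itv /= !andbT => /(le_trans (ltW s0)).
rewrite integralZl //; last by apply: integrableS iy.
rewrite EFinM; congr (_ * _)%E.
have -> : laplace_fun y lambda
  - \int[lebesgue_measure]_(t in `[0, s]) (expR (- lambda * t) * y t)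
  = \int[lebesgue_measure]_(t in `[s, +oo[) (expR (- lambda * t) * y t).
  rewrite -Rintegral_itv_obnd_cbnd.
    rewrite -(Rintegral_itvB (a := BLeft 0)) //=.
    by rewrite bnd_simp ltW.
  apply: integrableS iy => // u /=; rewrite !in_itv /= !andbT => su.
  by rewrite ltW // (lt_trans s0).
by rewrite /Rintegral fineK // integrable_fin_num //; apply: integrableS iy.
Qed.

Lemma cvg_mean_expM (lambda : R) : 0 < lambda ->
  Rintegral lebesgue_measure `[0, s] (fun t => expR (- lambda * t) * y t) / s
    @[s --> 0^'+] --> y 0.
Proof.
move=> l0.
pose f t := expR (- lambda * t) * y t.
have f0 : f 0 = y 0 by rewrite /f mulr0 expR0 mul1r.
apply/cvgrPdist_le => e e0.
have := @continuous_expM lambda 0.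
move=> /cvgrPdist_le /(_ e e0) [d /= d0 hd].
near=> s.
have s0 : 0 < s by near: s; exact: nbhs_right_gt.
have sd : s < d by near: s; exact: nbhs_right_lt.
have iy : lebesgue_measure.-integrable `[0, s] (EFin \o f).
  apply: integrableS (integrable_expM l0) => // u /=.
  by rewrite !in_itv /= andbT => /andP[].
have ic : forall c : R, lebesgue_measure.-integrable `[0, s] (EFin \o (fun=> c)).
  move=> c; apply: continuous_compact_integrable; first exact: segment_compact.
  by apply: continuous_subspaceT => x; exact: cst_continuous.
have cI c : \int[lebesgue_measure]_(t in `[0, s]) c = c * s.
  by rewrite Rintegral_cst //= lebesgue_measure_itv /= lte_fin s0 /= oppr0 addr0.
have fb t : t \in `[0, s] -> `|f 0 - f t| <= e.
  rewrite in_itv /= => /andP[t0 ts]; apply: hd.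
  by rewrite /= sub0r normrN ger0_norm // (le_lt_trans ts).
rewrite ler_norml; apply/andP; split.
- rewrite lerBrDl -lerBrDr opprK ler_pdivrMr // -cI.
  apply: le_Rintegral => // t /= ts.
  by have := fb t ts; rewrite f0 ler_norml /f => /andP[]; lra.
- rewrite lerBlDl -lerBlDr ler_pdivlMr // -cI.
  apply: le_Rintegral => // t /= ts.
  by have := fb t ts; rewrite f0 ler_norml /f => /andP[]; lra.
Unshelve. all: by end_near. Qed.

End laplace_fun_bounded.

(** Differentiation under the integral sign on the interval from [lambda / 2] to
    [2 lambda], where the derivative is at most [t exp (- lambda t / 2)]. *)
Lemma derivable_laplace_fun (R : realType) (y : R -> R) (lambda : R) :
  continuous y -> (forall t, 0 <= t -> 0 <= y t <= 1) ->
  0 < lambda -> derivable (laplace_fun y) lambda 1.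
Proof.
move=> y_cont y01 l0.
pose f (x t : R) := expR (- x * t) * y t.
have dexp (x t : R) :
    is_derive x 1 (fun x : R => expR (- x * t) * y t) (- t * expR (- x * t) * y t).
  apply: is_derive_eq; rewrite /GRing.scale /= !mulr0 !add0r; ring.
have d1f x t : partial1of2 f x t = - t * expR (- x * t) * y t.
  by rewrite /partial1of2 derive1E; apply: derive_val.
(* From [x <= exp x] at [x = lambda t / 4]: the factor [t] costs half of the
   exponential decay. *)
pose G (t : R) := 4 / lambda * (expR (- (lambda / 4) * t) * 1).
have l40 : 0 < lambda / 4 by rewrite divr_gt0.
apply: (@derivable_under_integral _ _ _ lebesgue_measure f `[0, +oo[ _
  lambda (lambda / 2) (2 * lambda) _ _ _ G) => //.
- by rewrite /= in_itv /=; lra.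
- move=> x; rewrite /= in_itv /= => /andP[x0 _].
  by apply: integrable_expM => //; lra.
- by move=> t; rewrite /G !mulr_ge0 ?expR_ge0 // ?invr_ge0 ltW.
- rewrite (_ : EFin \o G =
      fun t => ((4 / lambda)%:E * (expR (- (lambda / 4) * t) * 1)%:E)%E) //.
  apply: integrableZl => //.
  apply: (@integrable_expM _ (fun=> 1)) => // t; last by rewrite ler01 lexx.
  exact: cst_continuous.
- move=> x t; rewrite /= !in_itv /= andbT => /andP[x0 _] t0.
  have /andP[yt0 yt1] := y01 t t0.
  rewrite d1f -mulrA mulNr normrN ger0_norm; last by rewrite !mulr_ge0 // expR_ge0.
  rewrite /G mulr1.
  have h1 : t <= 4 / lambda * expR (lambda / 4 * t).
    have h : lambda / 4 * t <= expR (lambda / 4 * t).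
      by have := @expR_ge1Dx R (lambda / 4 * t); lra.
    have {1}-> : t = 4 / lambda * (lambda / 4 * t) by field; rewrite gt_eqF.
    by rewrite ler_wpM2l // divr_ge0 // ltW.
  apply: (@le_trans _ _ (4 / lambda * expR (lambda / 4 * t) * (expR (- x * t) * 1))).
    apply: ler_pM => //; first by rewrite mulr_ge0 ?expR_ge0.
    by rewrite ler_wpM2l ?expR_ge0.
  rewrite mulr1 -(mulrA (4 / lambda)) -expRD.
  apply: ler_wpM2l; first by rewrite divr_ge0 // ltW.
  rewrite ler_expR; nra.
Qed.

(** * The backward equation, after a Laplace transform *)

Lemma nneseriesD1T (R : realType) (f : nat -> \bar R) (i : nat) :
  (forall k, 0 <= f k)%E ->
  (\sum_(k <oo) f k = f i + \sum_(k <oo | k != i) f k)%E.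
Proof. by move=> f0; exact: (@nneseriesD1 _ f i xpredT). Qed.

(** [K s] is a substochastic kernel on [nat] with rates [q], and [D s] is the mass
    that it sends to a cemetery, at rate [kill].  The last clause says that no mass
    is lost otherwise.  With [kill = 0] this covers conservative chains on [nat]. *)
Definition killed_rates (R : realType) (K : R -> nat -> nat -> R)
    (q : nat -> nat -> R) (kill : nat -> R) : Prop :=
  forall i, [/\ (forall s k, 0 < s -> 0 <= K s i k),
    (forall k, (K s i k - (i == k)%:R) / s @[s --> 0^'+] --> q i k),
    (exists2 D : R -> R, D s / s @[s --> 0^'+] --> kill i &
       forall s, 0 < s ->
         0 <= D s /\ (\sum_(k <oo) (K s i k)%:E <= (1 - D s)%:E)%E) &
    (\sum_(k <oo | k != i) (q i k)%:E = (- q i i - kill i)%:E)%E].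

(** Probabilities of an event seen from each starting state: [t] is the time left
    and conditioning at time [s] gives the equation. *)
Definition backward_family (R : realType) (K : R -> nat -> nat -> R)
    (y : nat -> R -> R) : Prop :=
  (forall k t, 0 <= t -> 0 <= y k t <= 1) /\
  (forall i s t, 0 < s -> 0 <= t ->
    (\sum_(k <oo) (K s i k * y k t)%:E = (y i (s + t))%:E)%E).

Section backward.
Variables (R : realType) (K : R -> nat -> nat -> R) (q : nat -> nat -> R)
  (kill : nat -> R) (y : nat -> R -> R).
Hypothesis Kq : killed_rates K q kill.
Hypothesis Ky : backward_family K y.

Let K0 s i k : 0 < s -> 0 <= K s i k. Proof. by case: (Kq i) => + _ _ _; apply. Qed.
Let y0 k t : 0 <= t -> 0 <= y k t. Proof. by case: Ky => + _ t0 => /(_ k t t0)/andP[]. Qed.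
Let y1 k t : 0 <= t -> y k t <= 1. Proof. by case: Ky => + _ t0 => /(_ k t t0)/andP[]. Qed.

Lemma cvg_diag_kernel i : K s i i @[s --> 0^'+] --> (1 : R).
Proof.
have [_ /(_ i) + _ _] := Kq i; rewrite eqxx => cv.
have : (K s i i - 1%:R) / s * s + 1 @[s --> 0^'+] --> q i i * 0 + 1.
  apply: cvgD; last exact: cvg_cst.
  by apply: cvgM => //; apply: cvg_at_right_filter; exact: cvg_id.
rewrite mulr0 add0r; apply: cvg_trans; apply: near_eq_cvg.
near=> s; rewrite divfK ?subrK // gt_eqF //; near: s; exact: nbhs_right_gt.
Unshelve. all: by end_near. Qed.

(** In the equation for [y i (s + t)] the term [k = i] falls short of [y i t] by at
    most [1 - K s i i], and the other terms add at most as much.  The bound does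
    not depend on [t], which makes [y i] uniformly continuous. *)
Lemma backward_modulus i s t : 0 < s -> 0 <= t ->
  `|y i (s + t) - y i t| <= 1 - K s i i.
Proof.
move=> s0 t0.
have [_ _ [D _ /(_ s s0) [D0 KD]] _] := Kq i.
have e := Ky.2 i s t s0 t0.
have KK : (\sum_(k <oo | k != i) (K s i k)%:E <= (1 - K s i i)%:E)%E.
  rewrite EFinB leeBrDl // -(@nneseriesD1T _ (fun k => (K s i k)%:E)) //.
    by apply: le_trans KD _; rewrite lee_fin gerBl.
  by move=> k; rewrite lee_fin K0.
move: e; rewrite (@nneseriesD1T _ _ i) //; last first.
  by move=> k; rewrite lee_fin mulr_ge0 ?K0 ?y0.
set S := (\sum_(_ <oo | _) _)%E => e.
have S0 : (0 <= S)%E by apply: nneseries_ge0 => k _ _; rewrite lee_fin mulr_ge0 ?K0 ?y0.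
have S1 : (S <= (1 - K s i i)%:E)%E.
  apply: le_trans KK; apply: lee_nneseries => k; first by rewrite lee_fin mulr_ge0 ?K0 ?y0.
  by move=> _; rewrite lee_fin ler_piMr ?K0 ?y1.
have Sf : S \is a fin_num by rewrite ge0_fin_numE // (le_lt_trans S1) ?ltry.
move: S0 S1 e; rewrite -(fineK Sf) -EFinD !lee_fin => S0 S1 [<-].
have := y0 i t0; have := y1 i t0; have := K0 i i s0 => k0 yy1 yy0.
rewrite ler_norml; nra.
Qed.

Lemma backward_continuous i : continuous (fun t : R => y i (Num.max 0 t)).
Proof.
move=> x; apply/cvgrPdist_le => e e0.
have := cvg_diag_kernel i => /cvgrPdist_le /(_ e e0) [d /= d0 hd].
have key a b : 0 <= a -> a < b -> b - a < d -> `|y i b - y i a| <= e.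
  move=> a0 ab bad.
  have -> : b = (b - a) + a by rewrite subrK.
  apply: le_trans (backward_modulus _ _ _) _ => //; first by rewrite subr_gt0.
  have := hd (b - a); rewrite /= sub0r normrN ger0_norm ?subr_ge0 ?(ltW ab) //.
  move=> /(_ bad); rewrite subr_gt0 => /(_ ab); exact: le_trans (ler_norm _).
exists d => //= z; rewrite /ball_ /= => xz.
have [xz0|xz0|->] := ltgtP (Num.max 0 x) (Num.max 0 z).
- rewrite distrC; apply: key => //; first by rewrite le_max lexx.
  move: xz0 xz; rewrite ltr_norml => + /andP[].
  by rewrite /Num.max; do 2 case: ifP; lra.
- apply: key => //; first by rewrite le_max lexx.
  move: xz0 xz; rewrite ltr_norml => + /andP[].
  by rewrite /Num.max; do 2 case: ifP; lra.
- by rewrite subrr normr0 ltW.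
Qed.

(* Continuous on the whole line, unlike [y k] whose values at negative times are
   arbitrary. *)
Let Y k (t : R) := y k (Num.max 0 t).
Let Y01 k t : 0 <= t -> 0 <= Y k t <= 1.
Proof. by move=> t0; rewrite /Y max_r // y0 // y1. Qed.

Let YE k : laplace_fun (y k) = laplace_fun (Y k).
Proof.
apply/funext => l; apply: eq_Rintegral => t; rewrite inE /= in_itv /= andbT => t0.
by rewrite /Y max_r.
Qed.

Let Yc k : continuous (Y k). Proof. exact: backward_continuous. Qed.

Lemma backward_measurable i : measurable_fun (`[0, +oo[%classic : set R) (y i).
Proof.
apply: (@eq_measurable_fun _ _ _ _ _ (Y i)).
  by move=> t; rewrite inE /= in_itv /= andbT => t0; rewrite /Y max_r.
by apply: measurable_funTS; apply: continuous_measurable_fun; exact: Yc.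
Qed.

Lemma backward_laplaceE (lambda : R) i : 0 < lambda ->
  (\int[lebesgue_measure]_(t in `[0%R, +oo[) (expR (- lambda * t) * y i t)%:E
    = (laplace_fun (y i) lambda)%:E)%E.
Proof.
move=> l0; rewrite YE -laplace_funE //; last exact: Y01.
by apply: eq_integral => t; rewrite inE /= in_itv /= andbT => t0; rewrite /Y max_r.
Qed.

Lemma backward_laplace_bounds (lambda : R) i : 0 < lambda ->
  0 <= laplace_fun (y i) lambda <= lambda^-1.
Proof.
move=> l0; rewrite YE laplace_fun_ge0 ?laplace_fun_le //; exact: Y01.
Qed.

Lemma backward_laplace_derivable (lambda : R) i : 0 < lambda ->
  derivable (laplace_fun (y i)) lambda 1.
Proof.
move=> l0; rewrite YE; apply: derivable_laplace_fun => //; exact: Y01.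
Qed.

(** The Chapman-Kolmogorov equation is integrated against [exp (- lambda t)]
    and divided by [s]; as [s] tends to [0] the left-hand side converges by
    [scheffe_series], and the right-hand side [c s] converges to the derivative
    at [s = 0] of [exp (lambda s)] times the transform, less [y i 0]. *)
Lemma backward_laplace (lambda : R) i : 0 < lambda ->
  (\sum_(k <oo | k != i) (q i k * laplace_fun (y k) lambda)%:E
   = ((lambda - q i i) * laplace_fun (y i) lambda - y i 0)%:E)%E.
Proof.
move=> l0.
have [_ qik [D Dkill KD] qsum] := Kq i.
pose L k := laplace_fun (y k) lambda.
have LY k : L k = laplace_fun (Y k) lambda by rewrite /L YE.
pose I s := Rintegral lebesgue_measure `[0, s] (fun t => expR (- lambda * t) * Y i t).
pose c s := (expR (lambda * s) * (L i - I s) - K s i i * L i) / s.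
have LK s : 0 < s ->
   (\sum_(k <oo) (K s i k * L k)%:E = (expR (lambda * s) * (L i - I s))%:E)%E.
  move=> s0; rewrite LY -laplace_fun_shift //; last exact: Y01.
  transitivity (\sum_(k <oo)
     \int[lebesgue_measure]_(t in `[0%R, +oo[)
        ((K s i k)%:E * (expR (- lambda * t) * Y k t)%:E))%E.
    apply: eq_eseriesr => k _.
    rewrite ge0_integralZl //=.
    - by rewrite EFinM LY laplace_funE //; exact: Y01.
    - by apply/measurable_EFinP; apply: measurable_expM; exact: backward_continuous.
    - move=> t; rewrite in_itv /= andbT => t0.
      by case/andP: (Y01 k t0) => ? _; rewrite lee_fin mulr_ge0 ?expR_ge0.
    - by rewrite lee_fin K0.
  rewrite -integral_nneseries //; last 2 first.
  - move=> k; apply/measurable_EFinP; apply: measurable_funM; first exact: measurable_cst.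
    by apply: measurable_expM; exact: backward_continuous.
  - move=> k t /=; rewrite in_itv /= andbT => t0.
    by case/andP: (Y01 k t0) => ? _; rewrite lee_fin !mulr_ge0 ?expR_ge0 ?K0.
  apply: eq_integral => t; rewrite inE /= in_itv /= andbT => t0.
  have st0 : 0 <= s + t by rewrite addr_ge0 // ltW.
  rewrite [in RHS]/Y max_r // EFinM -(Ky.2 i s t) // -nneseriesZl; last first.
    by move=> k _; rewrite lee_fin mulr_ge0 ?K0 ?y0.
  by apply: eq_eseriesr => k _; rewrite /Y max_r // -!EFinM; congr EFin; ring.
have L0 k : 0 <= L k by rewrite LY laplace_fun_ge0 //; exact: Y01.
have L1 k : L k <= lambda^-1.
  by rewrite LY laplace_fun_le //; exact: Y01.
have ii : (i == i)%:R = 1 :> R by rewrite eqxx.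
apply: (@scheffe_series _ _ (fun s k => K s i k / s)
   (fun s => (1 - D s - K s i i) / s) c _ L (- q i i - kill i) lambda^-1).
- by move=> k _; rewrite L0 L1.
- by rewrite invr_ge0 ltW.
- by move=> s k s0 _; rewrite divr_ge0 ?K0 ?ltW.
- move=> k ki; have := qik k; rewrite eq_sym (negbTE ki).
  by under eq_cvg do rewrite subr0.
- exact: qsum.
- move=> s s0; have [D0 KDs] := KD s s0.
  under eq_eseriesr do rewrite mulrC EFinM.
  rewrite nneseriesZl; last by move=> k _; rewrite lee_fin K0.
  rewrite mulrC EFinM lee_pmul2l ?lte_fin ?invr_gt0 // EFinB leeBrDl //.
  rewrite -(@nneseriesD1T _ (fun k => (K s i k)%:E)) //.
  by move=> k; rewrite lee_fin K0.
- have -> : (fun s => (1 - D s - K s i i) / s) =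
      (fun s => - ((K s i i - (i == i)%:R) / s) - D s / s).
    by apply/funext => s; rewrite ii; ring.
  by apply: cvgB => //; exact: cvgN.
- move=> s s0; under eq_eseriesr do rewrite mulrAC mulrC EFinM.
  rewrite nneseriesZl; last by move=> k _; rewrite lee_fin mulr_ge0 ?K0 ?L0.
  rewrite /c mulrC EFinM; congr (_ * _)%E.
  rewrite EFinB -LK // (@nneseriesD1T _ _ i) //; last first.
    by move=> k; rewrite lee_fin mulr_ge0 ?K0 ?L0.
  by rewrite addeAC subee // add0e.
have -> : c = fun s => (expR (lambda * s) - 1) / s * L i - expR (lambda * s) * (I s / s)
     - (K s i i - (i == i)%:R) / s * L i.
  by apply/funext => s; rewrite /c ii; ring.
have -> : (lambda - q i i) * laplace_fun (y i) lambda - y i 0 =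
   lambda * L i - 1 * y i 0 - q i i * L i.
  by rewrite /L; ring.
have yi0 : y i 0 = Y i 0 by rewrite /Y max_r.
apply: cvgB; last by apply: cvgMl; exact: qik.
apply: cvgB.
- apply: cvgMl.
  have de : is_derive (0 : R) (1 : R) (fun s => expR (lambda * s)) lambda.
    by apply: is_derive_eq; rewrite mulr0 expR0 mul1r; exact: mulr1.
  have := @ex_derive _ _ _ _ _ _ _ de; have := @derive_val _ _ _ _ _ _ _ de.
  rewrite /derive /derivable => -> /cvg_dnbhs_at_right.
  apply: cvg_trans; apply: near_eq_cvg; apply: nearW => h /=.
  by rewrite /GRing.scale /= mulr1 addr0 mulr0 expR0 mulrC.
- rewrite yi0; apply: cvgM; last first.
    by apply: cvg_mean_expM => //; exact: Y01.
  apply: cvg_at_right_filter.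
  have := @continuous_expR_lin R lambda 0.
  by rewrite /continuous_at mulr0 expR0.
Qed.
End backward.

(** * Transition functions: absorbing states and the resurrection rates *)

Lemma esum_ge_term (R : realType) (S : choiceType) (a : S -> \bar R) (x : S) :
  (forall k, 0 <= a k)%E -> (a x <= \esum_(k in [set: S]) a k)%E.
Proof.
move=> a0; apply: esum_ge; exists [set x]; last by rewrite fsbig_set1.
by split=> //; exact: finite_set1.
Qed.

Lemma esum_option (R : realType) (a : option nat -> \bar R) :
  (forall k, 0 <= a k)%E ->
  (\esum_(k in [set: option nat]) a k = a None + \sum_(k <oo) a (Some k))%E.
Proof.
move=> a0; rewrite (esumID [set None]) => [|//]; rewrite !setTI esum_set1 //.
congr (_ + _)%E.
rewrite -(@esum_pred_image _ _ a Some xpredT) //.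
congr (esum _ a); apply/seteqP; split=> [[k|] //= _|_ [k _ <-] //].
by exists k.
Qed.

Lemma bernoulli_le (R : realType) (x : R) n : 0 <= x <= 1 -> 1 - x *+ n <= (1 - x) ^+ n.
Proof.
move=> /andP[x0 x1]; elim: n => [|n IH]; first by rewrite mulr0n subr0.
rewrite exprS mulrS; apply: (@le_trans _ _ ((1 - x) * (1 - x *+ n))).
  have : 0 <= x * (x *+ n) by rewrite mulr_ge0 // mulrn_wge0.
  lra.
by rewrite ler_wpM2l // subr_ge0.
Qed.

Section transition.
Variables (R : realType) (S : countType) (p : R -> S -> S -> R).
Hypothesis p_tr : transition_function p.

Lemma transition_le1 t i j : 0 <= t -> p t i j <= 1.
Proof.
case: p_tr => p0 p1 _ _ _ t0; rewrite -lee_fin; apply: le_trans (p1 t i t0).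
apply: (esum_ge_term (a := fun k => (p t i k)%:E)) => k.
by rewrite lee_fin p0.
Qed.

Lemma transition_ge_mul s t i : 0 <= s -> 0 <= t -> p s i i * p t i i <= p (s + t) i i.
Proof.
case: p_tr => p0 _ _ _ pD s0 t0; rewrite -lee_fin pD //.
apply: (esum_ge_term (a := fun k => (p s i k * p t k i)%:E)) => k.
by rewrite lee_fin mulr_ge0 ?p0.
Qed.

Lemma transition_ge_exp t i n : 0 <= t -> p t i i ^+ n <= p (t *+ n) i i.
Proof.
case: (p_tr) => p0 _ pI _ _ t0; elim: n => [|n IH].
  by rewrite expr0 mulr0n pI eqxx.
rewrite exprS mulrS; apply: le_trans (transition_ge_mul i t0 _); last by rewrite mulrn_wge0.
by rewrite ler_wpM2l ?p0.
Qed.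

(** By Chapman-Kolmogorov [p t i i >= p (t / n) i i ^+ n], and the zero
    derivative at 0 gives [p (t / n) i i >= 1 - e / n] for large [n]; Bernoulli's
    inequality then yields [p t i i >= 1 - e]. *)
Lemma absorbing_diag i : (p t i i - 1) / t @[t --> 0^'+] --> (0 : R) ->
  forall t, 0 <= t -> p t i i = 1.
Proof.
case: (p_tr) => p0 _ pI _ _ cv t; rewrite le_eqVlt => /predU1P[<-|t0].
  by rewrite pI eqxx.
apply/eqP; rewrite eq_le transition_le1 ?(ltW t0) //=.
apply/ler_addgt0Pr => e e0.
have et0 : 0 < e / t by rewrite divr_gt0.
move/cvgrPdist_le : cv => /(_ _ et0) [d /= d0 hd].
near \oo => n.
have n0 : (0 < n)%N by near: n; exact: nbhs_infty_gt.
have nR : 0 < n%:R :> R by rewrite ltr0n.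
have tn0 : 0 < t / n%:R by rewrite divr_gt0.
have ned : t / n%:R < d.
  rewrite ltr_pdivrMr // mulrC -ltr_pdivrMr //.
  near: n; exact: nbhs_infty_gtr.
have en1 : e / n%:R <= 1.
  rewrite ler_pdivrMr // mul1r; apply: ltW; near: n; exact: nbhs_infty_gtr.
have := hd (t / n%:R); rewrite /= sub0r normrN ger0_norm ?(ltW tn0) // => /(_ ned tn0).
rewrite sub0r normrN ler_norml => /andP[+ _].
rewrite ler_pdivlMr // mulNr.
have -> : e / t * (t / n%:R) = e / n%:R by rewrite mulrA divfK ?gt_eqF.
move=> h1.
have h2 : 1 - e / n%:R <= p (t / n%:R) i i by lra.
have h3 : (1 - e / n%:R) ^+ n <= p (t / n%:R) i i ^+ n.
  by apply: lerXn2r; rewrite ?nnegrE ?subr_ge0 ?p0 // ltW.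
have h4 := transition_ge_exp i n (ltW tn0).
have h5 : 1 - (e / n%:R) *+ n <= (1 - e / n%:R) ^+ n.
  by apply: bernoulli_le; rewrite en1 divr_ge0 // ltW.
move: h4 h5; rewrite -!mulrnAr -[n%:R^-1 *+ n]mulr_natr mulVf ?gt_eqF // !mulr1 => h4 h5.
rewrite -lerBlDr; exact: le_trans (le_trans h5 h3) h4.
Unshelve. all: by end_near. Qed.

Lemma absorbing_offdiag i j t : (forall t, 0 <= t -> p t i i = 1) -> i != j ->
  0 <= t -> p t i j = 0.
Proof.
case: (p_tr) => p0 p1 _ _ _ abs ij t0.
have := p1 t i t0; rewrite (esumID [set i]) => [|k _]; last by rewrite lee_fin p0.
rewrite !setTI esum_set1 ?lee_fin ?p0 // abs //.
rewrite -leeBrDl // subee // => h.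
apply/eqP; rewrite eq_le p0 // andbT -lee_fin; apply: le_trans h.
apply: esum_ge; exists [set j]; last by rewrite fsbig_set1.
split; first exact: finite_set1.
by move=> k /= ->; apply/eqP; rewrite eq_sym.
Qed.

End transition.

Section rates.
Variables (R : realType) (c : nat) (b h_ : nat -> R) (h : R).
Hypothesis b_ge0 : forall j : nat, j != 1%N -> 0 <= b j.
Hypothesis b1_lt0 : 0 < - b 1%N.
Hypothesis b_sum : (\sum_(j <oo | j != 1%N) (b j)%:E = (- b 1%N)%:E)%E.
Hypothesis h_ge0 : forall j : nat, (1 <= j)%N -> 0 <= h_ j.
Hypothesis h_sum : (\sum_(1 <= j <oo) (h_ j)%:E = h%:E)%E.
Hypothesis h_gt0 : 0 < h.

Let q := q_resurrection c b h_ h.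

Lemma resurrection_rate_ge0 i k : k != i -> 0 <= q i k.
Proof.
rewrite /q /q_resurrection => ki; case: ifP => i0.
  by rewrite (negbTE (_ : k != 0%N)) -?(eqP i0) // h_ge0 // lt0n -(eqP i0).
case: ifP => _; rewrite ?mulr_ge0 ?b_ge0 // (negbTE ki).
by case: ifP => // ik; rewrite b_ge0 // eqSS -lt0n subn_gt0.
Qed.

(** In row [i >= 1] the departures have rate [min(i, c) b_0] and the arrivals have
    rates [b_2, b_3, ...], whose sum is [- b_1 - b_0]. *)
Lemma resurrection_conservative i :
  (\sum_(k <oo | k != i) (q i k)%:E = (- q i i)%:E)%E.
Proof.
case: i => [|i].
  rewrite [in RHS]/q /q_resurrection /= opprK -h_sum [RHS]eseries_cond.
  rewrite [RHS](@eq_eseriesl _ _ (fun k => k != 0%N)) => [|k]; last by case: k.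
  by apply: eq_eseriesr => k k0; rewrite /q /q_resurrection /= (negbTE k0).
rewrite eseries_mkcond (nneseries_split 0 i.+2); last first.
  by move=> k _; case: ifP => // ki; rewrite lee_fin resurrection_rate_ge0.
rewrite add0n !big_nat_recr //= eqxx /= big1_seq; last first.
  move=> k; rewrite mem_index_iota /= => ki.
  rewrite ifT; last by rewrite ltn_eqF // ltnW // ltnS.
  rewrite /q /q_resurrection /= eqSS ltn_eqF // ltn_eqF ?(ltn_trans ki) //.
  by rewrite ltnNge (ltnW (ltn_trans ki _)).
rewrite ltn_eqF // add0e adde0.
rewrite -nneseries_addn; last first.
  by move=> k; case: ifP => // ki; rewrite lee_fin resurrection_rate_ge0.
pose g k : \bar R := if k != 1%N then (b k)%:E else 0%E.
have g0 k : (0 <= g k)%E by rewrite /g; case: ifP => // k1; rewrite lee_fin b_ge0.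
have gb : ((b 0%N)%:E + \sum_(k <oo) g (k + 2)%N = (- b 1%N)%:E)%E.
  rewrite nneseries_addn // -b_sum [RHS]eseries_mkcond [RHS](@nneseries_split _ g 0 2) //.
  by rewrite add0n !big_nat_recr //= big_geq // add0e adde0.
rewrite (eq_eseriesr (g := fun k => g (k + 2)%N)) => [|k _]; last first.
  have ik : (i.+1 < k + i.+2)%N by rewrite addnS ltnS leq_addl.
  have e : ((k + i.+2 - i.+1).+1 = k + 2)%N.
    by rewrite !addnS subSS subSn ?leq_addl // addnK addn0.
  rewrite /g /q /q_resurrection /= eqSS [(k + _)%N == i]gtn_eqF; last exact: ltn_trans ik.
  by rewrite [(k + _)%N == i.+1]gtn_eqF // ik e addn2.
case: (\sum_(_ <oo) _)%E gb => [S|//|//] /= [gb].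
rewrite -EFinD /q /q_resurrection /= !eqxx eqSS gtn_eqF //; congr EFin.
lra.
Qed.

Lemma resurrection_rate_le i : - q i i <= h - b 1%N + c%:R * b 0%N.
Proof.
have b0 : 0 <= b 0%N by exact: b_ge0.
have cb : 0 <= c%:R * b 0%N by rewrite mulr_ge0.
case: i => [|i]; rewrite /q /q_resurrection /=.
  by rewrite opprK -addrA lerDl addr_ge0 // ltW.
rewrite eqxx eqSS gtn_eqF //=.
have : (minn i.+1 c)%:R * b 0%N <= c%:R * b 0%N.
  by rewrite ler_wpM2r // ler_nat geq_minr.
set m := (minn _ _)%:R; set C := c%:R * _; have := h_gt0; have := b0.
move: (b 0%N) (b 1%N) m C h => *; lra.
Qed.

End rates.

(** * The two chains *)

Section queue.
Variables (R : realType) (c : nat) (b h_ : nat -> R) (h : R).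
Hypothesis b_ge0 : forall j : nat, j != 1%N -> 0 <= b j.
Hypothesis b_sum : (\sum_(j <oo | j != 1%N) (b j)%:E = (- b 1%N)%:E)%E.
Hypothesis h_ge0 : forall j : nat, (1 <= j)%N -> 0 <= h_ j.
Hypothesis h_sum : (\sum_(1 <= j <oo) (h_ j)%:E = h%:E)%E.

Let q := q_resurrection c b h_ h.

Section resurrection.
Variable p : R -> nat -> nat -> R.
Hypothesis p_trans : transition_function_of q p.

Lemma resurrection_killed_rates : killed_rates p q (fun=> 0).
Proof.
case: p_trans => -[p0 p1 pI _ _] pq i; split.
- by move=> s k s0; rewrite p0 // ltW.
- exact: pq.
- exists (fun=> 0) => [|s s0]; first by under eq_cvg do rewrite mul0r; exact: cvg_cst.
  split=> //; rewrite subr0 nneseries_esumT ?p1 ?(ltW s0) // => k.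
  by rewrite lee_fin p0 // ltW.
- by rewrite subr0; exact: resurrection_conservative.
Qed.

Lemma resurrection_backward : backward_family p (fun i t => p t i 0%N).
Proof.
case: p_trans => pt _; split.
  by move=> k t t0; rewrite (transition_le1 pt) // andbT; case: pt => + _ _ _ _; apply.
case: pt => p0 p1 _ _ pD i s t s0 t0; rewrite pD ?(ltW s0) // nneseries_esumT // => k.
by rewrite lee_fin mulr_ge0 ?p0 // ltW.
Qed.

Lemma resurrection_laplace (lambda : R) i : 0 < lambda ->
  (\sum_(k <oo | k != i) (q i k * laplace p k 0%N lambda)%:E
   = ((lambda - q i i) * laplace p i 0%N lambda - (i == 0%N)%:R)%:E)%E.
Proof.
move=> l0.
have := backward_laplace resurrection_killed_rates resurrection_backward i l0.
by case: p_trans => -[_ _ -> _ _] _.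
Qed.

End resurrection.

Variable beta : R.
Hypothesis beta_gt0 : 0 < beta.

Let qc := q_catastrophe c b h_ h beta.
Let kill (i : nat) : R := if (0 < i)%N then beta else 0.

Let kill_ge0 i : 0 <= kill i. Proof. by rewrite /kill; case: ifP => // _; exact: ltW. Qed.

Lemma q_catastrophe_offdiag i k : k != i -> qc (Some i) (Some k) = q i k.
Proof.
move=> ki; rewrite /qc /q_catastrophe /conservative_q_matrix ifF //.
by apply/negbTE; apply: contra ki => /eqP[->].
Qed.

(** Adding the jumps to [None] lowers the diagonal by their rate. *)
Lemma q_catastrophe_diag i : qc (Some i) (Some i) = q i i - kill i.
Proof.
rewrite /qc /q_catastrophe /conservative_q_matrix eqxx.
rewrite esum_mkcond esum_option => [|k]; last first.
  case: ifPn => // /[!inE] /= ki; rewrite lee_fin.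
  case: k ki => [k|] /= ki; last exact: (kill_ge0 i).
  by apply: resurrection_rate_ge0 => //; apply: contra ki => /eqP->.
rewrite ifT ?inE //=.
rewrite (_ : (\sum_(k <oo) _)%E = (- q i i)%:E); last first.
  rewrite -(@resurrection_conservative R c b h_ h) // [RHS]eseries_mkcond.
  apply: eq_eseriesr => k _ /=.
  have -> : (Some k \in [set k0 | k0 != Some i]) = (k != i).
    by apply: esym; apply/idP/idP=> [|/set_mem //] ki; rewrite inE.
  by case: ifP.
by rewrite -EFinD /= /kill; ring.
Qed.

Lemma q_catastrophe_absorbing : qc None None = 0.
Proof.
rewrite /qc /q_catastrophe /conservative_q_matrix /=.
by rewrite esum1 ?oppr0 // => -[].
Qed.

Variable m : R -> option nat -> option nat -> R.
Hypothesis m_trans : transition_function_of qc m.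

Lemma catastrophe_absorbing t x : 0 <= t -> m t None x = (None == x)%:R.
Proof.
case: m_trans => mt mq t0.
have a1 : forall t, 0 <= t -> m t None None = 1.
  apply: (absorbing_diag mt).
  by have := mq None None; rewrite q_catastrophe_absorbing eqxx.
case: x => [k|]; last by rewrite a1.
exact: (absorbing_offdiag mt a1).
Qed.

(** A sum over [nat] rather than [1 - m t (Some i) None]: a transition function may
    have rows of mass less than 1. *)
Definition survival (K : R -> option nat -> option nat -> R) (i : nat) (t : R) : R :=
  fine (\sum_(k <oo) (K t (Some i) (Some k))%:E)%E.

Let m0 t i k : 0 <= t -> 0 <= m t i k.
Proof. by case: m_trans => -[+ _ _ _ _] _; apply. Qed.

Let msum t i : 0 <= t ->
  ((m t i None)%:E + \sum_(k <oo) (m t i (Some k))%:E <= 1%:E)%E.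
Proof.
move=> t0; case: m_trans => -[_ /(_ t i t0) + _ _ _] _.
by rewrite esum_option // => k; rewrite lee_fin m0.
Qed.

Lemma survivalE t i : 0 <= t ->
  (survival m i t)%:E = (\sum_(k <oo) (m t (Some i) (Some k))%:E)%E.
Proof.
move=> t0; rewrite /survival fineK // ge0_fin_numE.
  apply: le_lt_trans (ltry 1); apply: le_trans (msum (Some i) t0).
  by rewrite leeDr // lee_fin m0.
by apply: nneseries_ge0 => k _ _; rewrite lee_fin m0.
Qed.

Lemma survival_ge0 t i : 0 <= t -> 0 <= survival m i t.
Proof.
move=> t0; rewrite -lee_fin survivalE //.
by apply: nneseries_ge0 => k _ _; rewrite lee_fin m0.
Qed.

Lemma survival_le t i : 0 <= t -> survival m i t <= 1 - m t (Some i) None.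
Proof.
move=> t0; rewrite lerBrDl -lee_fin EFinD survivalE //; exact: msum.
Qed.

Let K s i k := m s (Some i) (Some k).
Let q' i k := q i k - (i == k)%:R * kill i.

Lemma catastrophe_killed_rates : killed_rates K q' kill.
Proof.
case: (m_trans) => -[_ p1 pI _ _] pq i; split.
- by move=> s k s0; rewrite m0 // ltW.
- move=> k; have := pq (Some i) (Some k).
  rewrite /q' /K; have -> : (Some i == Some k) = (i == k) by [].
  case: eqVneq => [<-|ik]; first by rewrite mul1r q_catastrophe_diag.
  by rewrite mul0r subr0 q_catastrophe_offdiag // eq_sym.
- exists (fun s => m s (Some i) None) => [|s s0].
    by have := pq (Some i) None; under eq_cvg do rewrite subr0.
  split; first by rewrite m0 // ltW.
  by rewrite -survivalE ?lee_fin ?survival_le // ltW.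
- rewrite /q' eqxx mul1r opprB addrAC subrr add0r.
  rewrite -(@resurrection_conservative R c b h_ h) //.
  by apply: eq_eseriesr => k ki; rewrite eq_sym (negbTE ki) mul0r subr0.
Qed.

(** Paths that pass through [None] do not contribute, since it is absorbing. *)
Lemma catastrophe_backward : backward_family K (survival m).
Proof.
split.
  move=> k t t0; rewrite survival_ge0 //=; apply: le_trans (survival_le k t0) _.
  by rewrite gerBl m0.
move=> i s t s0 t0; have s0' := ltW s0; rewrite survivalE ?addr_ge0 //.
transitivity (\sum_(k <oo) \sum_(l <oo) (K s i k * m t (Some k) (Some l))%:E)%E.
  apply: eq_eseriesr => k _; rewrite EFinM survivalE // -nneseriesZl //.
  by move=> l _; rewrite lee_fin m0.
rewrite nneseries_interchange => [|k l]; last by rewrite lee_fin mulr_ge0 // ?m0.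
apply: eq_eseriesr => l _; case: (m_trans) => -[_ _ _ _ mD] _; rewrite mD //.
rewrite esum_option => [|k]; last by rewrite lee_fin mulr_ge0 ?m0.
by rewrite catastrophe_absorbing // mulr0 add0e.
Qed.

Lemma survival0 i : survival m i 0 = 1.
Proof.
apply: EFin_inj; rewrite survivalE // (nneseriesD1T i) => [|k]; last by rewrite lee_fin m0.
case: m_trans => -[_ _ mI _ _] _; rewrite mI eqxx eseries0 ?adde0 // => k _ ki.
rewrite mI; case: eqP => // -[ik]; by rewrite ik eqxx in ki.
Qed.

Lemma survival_laplace_backward (lambda : R) i : 0 < lambda ->
  (\sum_(k <oo | k != i) (q i k * laplace_fun (survival m k) lambda)%:E
   = ((lambda - q i i + kill i) * laplace_fun (survival m i) lambda - 1)%:E)%E.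
Proof.
move=> l0.
have := backward_laplace catastrophe_killed_rates catastrophe_backward i l0.
rewrite /q' eqxx mul1r survival0 opprB addrA addrAC => <-.
by apply: eq_eseriesr => k ki; rewrite [i == k]eq_sym (negbTE ki) mul0r subr0.
Qed.

End queue.

(** * The transform of the survival function *)

Section queue_laplace.
Variables (R : realType) (c : nat) (b h_ : nat -> R) (h beta : R).
Hypothesis b_ge0 : forall j : nat, j != 1%N -> 0 <= b j.
Hypothesis b1_lt0 : 0 < - b 1%N.
Hypothesis b_sum : (\sum_(j <oo | j != 1%N) (b j)%:E = (- b 1%N)%:E)%E.
Hypothesis h_ge0 : forall j : nat, (1 <= j)%N -> 0 <= h_ j.
Hypothesis h_sum : (\sum_(1 <= j <oo) (h_ j)%:E = h%:E)%E.
Hypothesis h_gt0 : 0 < h.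
Hypothesis beta_gt0 : 0 < beta.
Variable p : R -> nat -> nat -> R.
Hypothesis p_trans : transition_function_of (q_resurrection c b h_ h) p.
Variable m : R -> option nat -> option nat -> R.
Hypothesis m_trans : transition_function_of (q_catastrophe c b h_ h beta) m.

Let q := q_resurrection c b h_ h.
Let r i mu := laplace p i 0%N mu.
Let u i lambda := laplace_fun (survival m i) lambda.
Let q0 i k : k != i -> 0 <= q i k.
Proof. exact: resurrection_rate_ge0. Qed.
Let qQ i : (\sum_(k <oo | k != i) (q i k)%:E = (- q i i)%:E)%E.
Proof. exact: resurrection_conservative. Qed.
Let qL i : - q i i <= h - b 1%N + c%:R * b 0%N.
Proof. exact: resurrection_rate_le. Qed.

Lemma resurrection_laplace_bounds i mu : 0 < mu -> 0 <= r i mu <= mu^-1.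
Proof.
move=> m0; apply: (backward_laplace_bounds _ (resurrection_backward p_trans)) => //.
exact: (resurrection_killed_rates b_ge0 b_sum h_ge0 h_sum p_trans).
Qed.

Lemma resurrection_laplace_derivable i mu : 0 < mu -> derivable (r i) mu 1.
Proof.
move=> m0; apply: (backward_laplace_derivable _ (resurrection_backward p_trans)) => //.
exact: (resurrection_killed_rates b_ge0 b_sum h_ge0 h_sum p_trans).
Qed.

(** With [mu = lambda + beta], both sides are bounded solutions [x] of
    [(mu - q) x = 1 + beta * u 0 lambda * e_0]: on the left the killing term,
    absent in state 0, is compensated by the right-hand side, and on the right
    this is linearity. *)
Lemma survival_laplace_return lambda i : 0 < lambda ->
  u i lambda = (lambda + beta)^-1 + beta * u 0%N lambda * r i (lambda + beta).
Proof.
move=> l0.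
have mu0 : 0 < lambda + beta by rewrite addr_gt0.
pose z k := (lambda + beta)^-1 + beta * u 0%N lambda * r k (lambda + beta).
have rb k : 0 <= r k (lambda + beta) <= (lambda + beta)^-1.
  exact: resurrection_laplace_bounds.
have ub k : 0 <= u k lambda <= lambda^-1.
  apply: (backward_laplace_bounds _ (catastrophe_backward m_trans)) => //.
  exact: (catastrophe_killed_rates b_ge0 b_sum h_ge0 h_sum beta_gt0 m_trans).
have u0 : 0 <= u 0%N lambda by case/andP: (ub 0%N).
have bu0 : 0 <= beta * u 0%N lambda by rewrite mulr_ge0 // ltW.
pose B := lambda^-1 + ((lambda + beta)^-1 + beta * u 0%N lambda * (lambda + beta)^-1).
have m0' : 0 <= (lambda + beta)^-1 by rewrite invr_ge0 ltW.
have l0' : 0 <= lambda^-1 by rewrite invr_ge0 ltW.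
suff : (fun i => u i lambda) =1 z by apply.
apply: (@bounded_solution_unique _ q (fun i => - q i i)
  (fun i => 1 + beta * u 0%N lambda * (i == 0%N)%:R) _ _ (lambda + beta)
  (h - b 1%N + c%:R * b 0%N) B) => //.
- move=> k; case/andP: (ub k) => -> h1 /=; apply: le_trans h1 _.
  by rewrite /B lerDl addr_ge0 // (mulr_ge0 bu0).
- move=> k; case/andP: (rb k) => h1 h2; rewrite /z (addr_ge0 m0' (mulr_ge0 bu0 h1)) /=.
  by rewrite /B ler_wpDl // lerD2l ler_wpM2l.
- move=> k.
  rewrite (survival_laplace_backward b_ge0 b_sum h_ge0 h_sum beta_gt0 m_trans) //.
  congr EFin.
  by case: k => [|k]; rewrite /u /q /= ?mulr1n ?mulr0n; ring.
- move=> k; rewrite /z.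
  under eq_eseriesr => l lk.
    rewrite mulrDr [q k l * _^-1]mulrC [q k l * (_ * _)]mulrCA.
    rewrite EFinD !(EFinM (_^-1)) (EFinM (beta * _)). over.
  rewrite nneseriesD => [|l _ lk|l _ lk].
  + rewrite !nneseriesZl => [|l lk|l lk].
    * rewrite qQ (resurrection_laplace b_ge0 b_sum h_ge0 h_sum p_trans) //.
      rewrite -/(r k _) -!EFinM -EFinD; congr EFin.
      by rewrite /q /r; field; rewrite gt_eqF.
    * by rewrite lee_fin mulr_ge0 ?q0 //; case/andP: (rb l).
    * by rewrite lee_fin q0.
  + by rewrite -EFinM lee_fin mulr_ge0 ?q0.
  + by rewrite -EFinM lee_fin (mulr_ge0 bu0) // mulr_ge0 ?q0 //; case/andP: (rb l).
Qed.

(** A state [k > 0] must be left before 0 is reached, so its row of the backward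
    equation gives [r k beta <= rho / beta] with
    [rho = Lam / (beta + Lam) < 1]; the row of 0, whose jump rate [h] is positive,
    then gives a strict inequality. *)
Lemma beta_laplace_lt1 : beta * r 0%N beta < 1.
Proof.
pose Lam := h - b 1%N + c%:R * b 0%N.
have rb i : 0 <= r i beta <= beta^-1 by exact: resurrection_laplace_bounds.
have L0 : 0 < Lam by rewrite /Lam -addrA ltr_pwDl // addr_ge0 ?mulr_ge0 ?b_ge0 // ltW.
have bL : 0 < beta + Lam by rewrite addr_gt0.
pose rho := Lam / (beta + Lam).
have rho0 : 0 <= rho by rewrite divr_ge0 // ltW.
have rho1 : rho < 1 by rewrite ltr_pdivrMr // mul1r ltrDr.
have Q0 i : 0 <= - q i i.
  by rewrite -lee_fin -qQ; apply: nneseries_ge0 => k _ ki; rewrite lee_fin q0.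
have r1 k : (0 < k)%N -> r k beta <= beta^-1 * rho.
  move=> k0.
  have : (beta - q k k) * r k beta <= beta^-1 * - q k k.
    rewrite -lee_fin (EFinM _^-1) -qQ -nneseriesZl => [|l lk]; last by rewrite lee_fin q0.
    have := resurrection_laplace b_ge0 b_sum h_ge0 h_sum p_trans k beta_gt0.
    rewrite [k == 0%N]gtn_eqF // subr0 => <-.
    apply: lee_nneseries => [l _ lk|l lk].
      by rewrite lee_fin mulr_ge0 ?q0 //; case/andP: (rb l).
    by rewrite -EFinM lee_fin mulrC ler_wpM2r ?q0 //; case/andP: (rb l).
  have bq : 0 < beta - q k k by rewrite ltr_pwDl.
  move=> hk; rewrite -(ler_pM2l bq); apply: le_trans hk _.
  rewrite mulrCA ler_wpM2l ?invr_ge0 ?(ltW beta_gt0) // /rho mulrA ler_pdivlMr //.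
  have gen (x y z : R) : x * y <= x * z -> y * (x + z) <= (x + y) * z by lra.
  by apply: gen; rewrite ler_wpM2l ?qL // ltW.
have := resurrection_laplace b_ge0 b_sum h_ge0 h_sum p_trans 0 beta_gt0.
rewrite eqxx => e0.
have : (beta - q 0%N 0%N) * r 0%N beta - 1 <= beta^-1 * rho * - q 0%N 0%N.
  rewrite -lee_fin -e0 [leRHS]EFinM -qQ -nneseriesZl => [|l lk]; last by rewrite lee_fin q0.
  apply: lee_nneseries => [l _ lk|l lk].
    by rewrite lee_fin mulr_ge0 ?q0 //; case/andP: (rb l).
  by rewrite -EFinM lee_fin mulrC ler_wpM2r ?q0 // r1 // lt0n.
rewrite /q /q_resurrection /= !opprK => hh.
have bh : 0 < beta + h by rewrite addr_gt0.
have hr : h * rho < h by rewrite gtr_pMr.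
have e : beta * (beta^-1 * rho * h) = h * rho by field; rewrite gt_eqF.
rewrite -(ltr_pM2l bh).
have : beta * ((beta + h) * r 0%N beta - 1) <= h * rho by rewrite -e ler_wpM2l // ltW.
rewrite mulr1 mulrBr mulr1 mulrCA; lra.
Qed.

(** The function [H] of the introduction. *)
Definition survival_transform j (mu : R) : R :=
  mu^-1 * (1 + beta * r j mu / (1 - beta * r 0%N mu)).

Lemma survival_laplaceE lambda j : 0 < lambda ->
  u j lambda = survival_transform j (lambda + beta).
Proof.
move=> l0; have mu0 : 0 < lambda + beta by rewrite addr_gt0.
have e := survival_laplace_return 0 l0.
rewrite survival_laplace_return // /survival_transform.
set mu := lambda + beta in mu0 e *.
have e' : u 0%N lambda * (1 - beta * r 0%N mu) = mu^-1.
  by rewrite mulrBr mulr1 {1}e; ring.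
have D0 : 1 - beta * r 0%N mu != 0.
  apply/eqP => D0; move: e'; rewrite D0 mulr0 => /esym/eqP.
  by rewrite invr_eq0 gt_eqF.
have -> : u 0%N lambda = mu^-1 / (1 - beta * r 0%N mu) by rewrite -e' mulfK.
by field; rewrite D0 gt_eqF.
Qed.

Lemma survival_transform_derive j :
  is_derive beta 1 (survival_transform j)
   (- beta ^- 2 - (beta^-1 * r j beta / (1 - beta * r 0%N beta))
    + (derive1 (r j) beta / (1 - beta * r 0%N beta)
       + beta * r j beta * derive1 (r 0%N) beta / (1 - beta * r 0%N beta) ^+ 2)).
Proof.
have D0 : 1 - beta * r 0%N beta != 0 by rewrite gt_eqF // subr_gt0 beta_laplace_lt1.
have dj : is_derive beta 1 (r j) (derive1 (r j) beta).
  by rewrite derive1E; apply: derivableP; exact: resurrection_laplace_derivable.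
have d0 : is_derive beta 1 (r 0%N) (derive1 (r 0%N) beta).
  by rewrite derive1E; apply: derivableP; exact: resurrection_laplace_derivable.
have dV : is_derive beta 1 (fun mu => (1 - beta * r 0%N mu)^-1)
    (- (1 - beta * r 0%N beta) ^- 2
       *: (0 - (beta *: derive1 (r 0%N) beta + r 0%N beta *: 0))).
  by apply: is_deriveV.
have dI : is_derive beta 1 (fun mu : R => mu^-1) (- beta ^- 2 *: 1).
  by apply: is_deriveV; rewrite gt_eqF.
apply: is_derive_eq.
rewrite /GRing.scale /=.
by field; rewrite D0 gt_eqF.
Qed.

End queue_laplace.

(** * Moments from the transform near zero *)

(** Fatou's lemma gives one inequality and the bound [f n <= g] the other;
    integrability of [g] is a consequence. *)
Lemma cvg_integral_dominating d (T : measurableType d) (R : realType)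
    (mu : {measure set T -> \bar R}) (D : set T) (f : nat -> T -> R) (g : T -> R) (L : R) :
  measurable D ->
  (forall n, measurable_fun D (f n)) -> measurable_fun D g ->
  (forall n x, D x -> 0 <= f n x <= g x) ->
  (forall x, D x -> f n x @[n --> \oo] --> g x) ->
  (\int[mu]_(x in D) (f n x)%:E @[n --> \oo] --> L%:E)%E ->
  (\int[mu]_(x in D) (g x)%:E = L%:E)%E.
Proof.
move=> mD mf mg fg fcv icv.
have f0 n x : D x -> 0 <= f n x by move=> Dx; case/andP: (fg n x Dx).
have fle n x : D x -> f n x <= g x by move=> Dx; case/andP: (fg n x Dx).
apply/eqP; rewrite eq_le; apply/andP; split.
- have mfE n : measurable_fun D (fun x => (f n x)%:E) by exact/measurable_EFinP.
  have fE0 n x : D x -> (0 <= (f n x)%:E)%E by move=> Dx; rewrite lee_fin f0.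
  have := fatou mu mD mfE fE0.
  rewrite (cvg_limn_einf_sup icv).1; apply: le_trans.
  rewrite le_eqVlt; apply/orP; left; apply/eqP; apply: eq_integral => x /set_mem Dx.
  have cx : (f n x)%:E @[n --> \oo] --> (g x)%:E.
    by apply: cvg_EFin; [exact: nearW|exact: fcv].
  by rewrite (cvg_limn_einf_sup cx).1.
- apply: (cvge_to_le icv); apply: nearW => n.
  apply: ge0_le_integral => //.
  + by move=> x Dx; rewrite lee_fin f0.
  + exact/measurable_EFinP.
  + exact/measurable_EFinP.
  + by move=> x Dx; rewrite lee_fin fle.
Qed.

Section moments.
Variables (R : realType) (y U : R -> R).
Let D : set R := `[0, +oo[.
Hypothesis my : measurable_fun D y.
Hypothesis y0 : forall t, 0 <= t -> 0 <= y t.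
Hypothesis yU : forall lambda : R, 0 < lambda ->
  (\int[lebesgue_measure]_(t in D) (expR (- lambda * t) * y t)%:E = (U lambda)%:E)%E.
Variable L : R.
Hypothesis UL : U lambda @[lambda --> 0^'+] --> L.

Let me (lambda : R) : measurable_fun D (fun t => expR (- lambda * t)).
Proof.
by apply: measurable_funTS; apply: continuous_measurable_fun; exact: continuous_expR_lin.
Qed.

Let Dge0 t : D t -> 0 <= t. Proof. by rewrite /D /= in_itv /= andbT. Qed.

Let harmonic_right (A : R -> R) (l : R) : A x @[x --> 0^'+] --> l ->
  A (harmonic n) @[n --> \oo] --> l.
Proof.
by move=> /cvg_at_rightP; apply; split; [move=> n; exact: harmonic_gt0|exact: cvg_harmonic].
Qed.

Lemma integral_transform_limit :
  (\int[lebesgue_measure]_(t in D) (y t)%:E = L%:E)%E.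
Proof.
apply: (@cvg_integral_dominating _ _ R lebesgue_measure D
  (fun n t => expR (- harmonic n * t) * y t)) => //.
- exact: measurable_itv.
- by move=> n; apply: measurable_funM => //; exact: me.
- move=> n t /Dge0 t0; rewrite mulr_ge0 ?expR_ge0 ?y0 //= ler_piMl ?y0 //.
  by rewrite -expR0 ler_expR mulNr oppr_le0 mulr_ge0 // ltW // harmonic_gt0.
- move=> t Dt; rewrite -[X in _ --> X]mul1r; apply: cvgMl.
  rewrite -expR0 -(mul0r t); apply: continuous_cvg; first exact: continuous_expR.
  apply: cvgMl; rewrite -oppr0; apply: cvgN; exact: cvg_harmonic.
- under eq_cvg do rewrite yU ?harmonic_gt0 //.
  by apply: cvg_EFin; [exact: nearW|exact: harmonic_right].
Qed.

(** [(1 - exp (- l t)) / l] tends to [t] from below as [l] decreases to 0, and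
    its integral against [y] is [(L - U l) / l]. *)
Lemma integral_transform_derivative (L1 : R) :
  (L - U lambda) / lambda @[lambda --> 0^'+] --> L1 ->
  (\int[lebesgue_measure]_(t in D) (t * y t)%:E = L1%:E)%E.
Proof.
move=> UL1.
pose f (l t : R) := (1 - expR (- l * t)) / l * y t.
have f0 l t : 0 < l -> 0 <= t -> 0 <= f l t.
  move=> l0 t0; rewrite mulr_ge0 ?y0 // divr_ge0 ?(ltW l0) // subr_ge0.
  by rewrite -expR0 ler_expR mulNr oppr_le0 mulr_ge0 // ltW.
have mf l : measurable_fun D (f l).
  apply: measurable_funM => //; apply: measurable_funM => //.
  by apply: measurable_funB.
have intf l : 0 < l -> (\int[lebesgue_measure]_(t in D) (f l t)%:E = ((L - U l) / l)%:E)%E.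
  move=> l0.
  have e : (\int[lebesgue_measure]_(t in D)
      (l%:E * (f l t)%:E + (expR (- l * t) * y t)%:E) = L%:E)%E.
    rewrite -integral_transform_limit; apply: eq_integral => t _.
    by rewrite -EFinM -EFinD; congr EFin; rewrite /f; field; rewrite gt_eqF.
  move: e; rewrite ge0_integralD //; first last.
  - by apply/measurable_EFinP; apply: measurable_funM => //; exact: me.
  - by move=> t /Dge0 t0; rewrite lee_fin mulr_ge0 ?expR_ge0 ?y0.
  - by apply/measurable_EFinP; apply: measurable_funM => //; exact: mf.
  - by move=> t /Dge0 t0; rewrite lee_fin mulr_ge0 ?f0 // ltW.
  - exact: measurable_itv.
  rewrite ge0_integralZl //; first last.
  - by rewrite lee_fin ltW.
  - by move=> t /Dge0 t0; rewrite lee_fin f0.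
  - by apply/measurable_EFinP; exact: mf.
  - exact: measurable_itv.
  rewrite yU //; set I := (\int[_]_(_ in _) _)%E.
  case: I => [I|//|//] /=.
  + rewrite -EFinM -EFinD => -[<-]; congr EFin; field; by rewrite gt_eqF.
  + by rewrite gt0_muley ?lte_fin.
  + by rewrite gt0_muleNy ?lte_fin.
apply: (@cvg_integral_dominating _ _ R lebesgue_measure D
  (fun n t => f (harmonic n) t)) => //.
- exact: measurable_itv.
- by move=> n; exact: mf.
- by apply: measurable_funM.
- move=> n t /Dge0 t0; rewrite f0 ?harmonic_gt0 //= ler_wpM2r ?y0 //.
  rewrite ler_pdivrMr ?harmonic_gt0 // lerBlDl -lerBlDr.
  rewrite [t * _]mulrC -mulNr; exact: expR_ge1Dx.
- move=> t /Dge0 t0; apply: cvgMl.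
  apply: (@harmonic_right (fun l => (1 - expR (- l * t)) / l)).
  have de : is_derive (0 : R) (1 : R) (fun l => - expR (- l * t)) t.
    by apply: is_derive_eq; rewrite oppr0 mul0r expR0 /GRing.scale /=; ring.
  have := @ex_derive _ _ _ _ _ _ _ de; have := @derive_val _ _ _ _ _ _ _ de.
  rewrite /derive /derivable => -> /cvg_dnbhs_at_right.
  apply: cvg_trans; apply: near_eq_cvg; apply: nearW => l /=.
  by rewrite /GRing.scale /= mulr1 addr0 oppr0 mul0r expR0 mulrC opprK addrC.
- under eq_cvg do rewrite intf ?harmonic_gt0 //.
  by apply: cvg_EFin; [exact: nearW|exact: (@harmonic_right (fun l => (L - U l) / l))].
Qed.

End moments.

(** * The law of the first catastrophe time *)

(** The absolute value makes the whole sequence nonnegative; the enumeration by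
    [nat] suits countable unions. *)
Definition rational_time (R : realType) (n : nat) : R :=
  `|ratr (odflt 0 (unpickle n : option rat))|.

Lemma rational_time_ge0 (R : realType) n : 0 <= rational_time R n.
Proof. exact: normr_ge0. Qed.

Lemma rational_time_dense (R : realType) (x y : R) : 0 <= x -> x < y ->
  exists n, x < rational_time R n < y.
Proof.
move=> x0 xy; have [q] := rat_in_itvoo xy.
rewrite in_itv /= => xqy; exists (pickle q).
by rewrite /rational_time pickleK /= ger0_norm //; case/andP: xqy => /ltW/(le_trans x0).
Qed.

Section chain.
Variables (R : realType) (d : measure_display) (Omega : measurableType d)
  (P : probability Omega R) (M : R -> Omega -> option nat).
Variables (c : nat) (b h_ : nat -> R) (h beta : R).
Variable m : R -> option nat -> option nat -> R.
Hypothesis m_trans : transition_function_of (q_catastrophe c b h_ h beta) m.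
Hypothesis M_meas : forall t i, 0 <= t -> measurable [set w | M t w = i].
Hypothesis M_right : forall w t, 0 <= t -> \forall s \near t^'+, M s w = M t w.
Variable j : nat.
Hypothesis M_start : P [set w | M 0 w = Some j] = 1%:E.
Hypothesis M_fdd : forall (n : nat) (t : nat -> R) (x : nat -> option nat),
  0 <= t 0%N -> (forall k, t k <= t k.+1) ->
  P [set w | forall k, (k <= n.+1)%N -> M (t k) w = x k]
  = (P [set w | forall k, (k <= n)%N -> M (t k) w = x k]
     * (m (t n.+1 - t n) (x n) (x n.+1))%:E)%E.

Let start : set Omega := [set w | M 0 w = Some j].

Let not_start : P.-negligible (~` start).
Proof.
have mS : measurable start by exact: M_meas.
apply/negligibleP; first exact: measurableC.
by have := probability_setC P mS; rewrite M_start subee.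
Qed.

Let measure_start (A : set Omega) : measurable A -> P (start `&` A) = P A.
Proof.
move=> mA; have mS : measurable start by exact: M_meas.
rewrite -[in RHS](setTI A) -(setUv start) setIUl measureU //; last first.
- by rewrite setIACA setICr set0I.
- by apply: measurableI => //; exact: measurableC.
- exact: measurableI.
rewrite [X in (_ + X)%E](_ : _ = 0%E) ?adde0 //.
apply: measure_negligible; first by apply: measurableI => //; exact: measurableC.
by apply: negligibleS not_start => w [].
Qed.

Lemma chain_marginal t x : 0 <= t -> P [set w | M t w = x] = (m t (Some j) x)%:E.
Proof.
move=> t0.
pose tt k : R := if k is 0 then 0 else t.
pose xx k := if k is 0 then Some j else x.
have := @M_fdd 0 tt xx (lexx 0).
rewrite /= subr0.
have -> : [set w | forall k, (k <= 0)%N -> M (tt k) w = xx k] = start.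
  by apply/seteqP; split=> w /= => [e|e [|k] //]; exact: (e 0%N isT).
have -> : [set w | forall k, (k <= 1)%N -> M (tt k) w = xx k] =
    start `&` [set w | M t w = x].
  apply/seteqP; split=> w /= => [e|[e0 e1] [|[|k]] //].
  by split; [exact: (e 0%N isT)|exact: (e 1%N isT)].
by rewrite measure_start ?M_start ?mul1e => [-> //|]; [case|exact: M_meas].
Qed.

(** On the event that [M t] is [Some k], the three-time marginal at 0, [s] and [t]
    has the factor [m (t - s) None (Some k) = 0]. *)
Lemma chain_absorbed s t : 0 <= s -> s <= t ->
  P.-negligible [set w | M s w = None /\ M t w <> None].
Proof.
move=> s0 st; have t0 := le_trans s0 st.
pose F k := [set w | M s w = None /\ M t w = Some k].
suff Fk k : P.-negligible (F k).
  apply: negligibleS (negligible_bigcup Fk) => w /= [ws wt].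
  by case e : (M t w) wt => [k|//] _; exists k.
have F3 : P (start `&` F k) = 0%E.
  have := @M_fdd 1 (fun i => nth t [:: 0; s] i)
    (fun i => nth (Some k) [:: Some j; None] i) (lexx 0).
  rewrite /= (catastrophe_absorbing m_trans) ?subr_ge0 // mule0 => H.
  rewrite -[RHS]H; last by case=> [|[|i]] //=; rewrite ?nth_nil.
  congr (P _); apply/seteqP; split=> w /= => [[e0 [e1 e2]] [|[|[|i]]] //|e].
  by split; [exact: (e 0%N isT)|split; [exact: (e 1%N isT)|exact: (e 2%N isT)]].
have mF : measurable (F k) by apply: measurableI; exact: M_meas.
by apply/negligibleP => //; have := measure_start mF; rewrite F3 => /esym.
Qed.

Lemma chain_survival t : 0 <= t -> P [set w | M t w <> None] = (survival m j t)%:E.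
Proof.
move=> t0; rewrite (survivalE m_trans) //.
have -> : [set w | M t w <> None] = \bigcup_k [set w | M t w = Some k].
  apply/seteqP; split=> w /= => [|[k _ /= ->] //].
  by case e : (M t w) => [k|] // _; exists k.
rewrite measure_semi_bigcup; last 3 first.
- by move=> k; exact: M_meas.
- by move=> i k _ _ [w [/= Mi]]; rewrite Mi => -[].
- by apply: bigcup_measurable => k _; exact: M_meas.
by apply: eq_eseriesr => k _; exact: chain_marginal.
Qed.

Let A n : set Omega := [set w | M (rational_time R n) w = None].

Let mA n : measurable (A n). Proof. by apply: M_meas; exact: rational_time_ge0. Qed.

(** By right continuity a visit to [None] at time [s] lasts until some later
    rational time, which can be taken before [t]. *)
Lemma hitting_time_ltP w (t : R) :
  (hitting_time M None w < t%:E)%E <->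
  exists2 n, rational_time R n < t & A n w.
Proof.
split=> [/ereal_inf_lt [_ [s [s0 Ms] <-]]|[n nt An]].
  rewrite lte_fin => st.
  have [e /= e0 Me] := M_right w s0.
  have [] := @rational_time_dense R s (Num.min t (s + e)) s0.
    by rewrite lt_min st ltrDl.
  move=> n /andP[sn]; rewrite lt_min => /andP[nt nse]; exists n => //.
  rewrite /A /= -Ms; apply: Me => //=.
  by rewrite distrC ger0_norm ?subr_ge0 ?(ltW sn) // ltrBlDl.
apply: le_lt_trans (_ : (rational_time R n)%:E < _)%E; last by rewrite lte_fin.
apply: ereal_inf_lbound; exists (rational_time R n) => //.
by split=> //; exact: rational_time_ge0.
Qed.

Lemma hitting_time_ltE (t : R) : [set w | (hitting_time M None w < t%:E)%E]
  = \bigcup_(n in [set n | rational_time R n < t]) A n.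
Proof.
apply/seteqP; split=> w /= => [/hitting_time_ltP [n nt An]|[n nt An]].
  by exists n.
by apply/hitting_time_ltP; exists n.
Qed.

Lemma hitting_time_ge0 w : (0 <= hitting_time M None w)%E.
Proof. by apply: le_ereal_inf_tmp => _ [s [s0 _] <-]; rewrite lee_fin. Qed.

Lemma measurable_hitting_time_lt t : measurable [set w | (hitting_time M None w < t%:E)%E].
Proof.
by rewrite hitting_time_ltE; apply: bigcup_measurable => n _; exact: mA.
Qed.

Lemma measurable_hitting_time_ge t : measurable [set w | (t%:E <= hitting_time M None w)%E].
Proof.
have -> : [set w | (t%:E <= hitting_time M None w)%E] =
    ~` [set w | (hitting_time M None w < t%:E)%E].
  by apply/seteqP; split=> w /=; [rewrite leNgt => /negP|move=> /negP; rewrite -leNgt].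
exact/measurableC/measurable_hitting_time_lt.
Qed.

Lemma measurable_hitting_time : measurable_fun setT (hitting_time M None).
Proof.
apply: (measurability _ (ErealGenCInfty.measurableE R)) => // _ [_ [x ->]] <-.
rewrite setTI (_ : _ @^-1` _ = [set w | (x%:E <= hitting_time M None w)%E]).
  exact: measurable_hitting_time_ge.
by apply/seteqP; split=> w; rewrite /= in_itv /= andbT.
Qed.

(** The complement is a countable union of rectangles: [w] in [A n] and [t] after
    the [n]-th rational time. *)
Lemma measurable_hitting_time_region :
  measurable [set wt : Omega * R | (wt.2%:E <= hitting_time M None wt.1)%E].
Proof.
have -> : [set wt : Omega * R | (wt.2%:E <= hitting_time M None wt.1)%E] =
  ~` (\bigcup_n (A n `*` `]rational_time R n, +oo[)).
  apply/seteqP; split=> -[w t] /=.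
    rewrite leNgt => /negP wt [n _ [/= An]]; rewrite in_itv /= andbT => nt.
    by apply: wt; apply/hitting_time_ltP; exists n.
  move=> wt; rewrite leNgt; apply/negP => /hitting_time_ltP [n nt An].
  by apply: wt; exists n => //; split=> //=; rewrite in_itv /= nt.
apply: measurableC; apply: bigcup_measurable => n _.
by apply: measurableX => //; exact: mA.
Qed.

(** If [M t] is alive then, outside a null set, so is [M] at all earlier rational
    times, which gives [P (t <= C) >= survival m j t].  Conversely [t <= C] implies
    that [M u] is alive for every [u < t]; the continuity of the survival function
    closes the gap between [u] and [t]. *)
Lemma hitting_time_tail t : 0 <= t ->
  {for t, continuous (fun t : R => survival m j (Num.max 0 t))} ->
  P [set w | (t%:E <= hitting_time M None w)%E] = (survival m j t)%:E.
Proof.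
rewrite le_eqVlt => /predU1P[<- _|t0 ct].
  rewrite (survival0 m_trans) (_ : [set w | _] = setT) ?probability_setT //.
  by apply/seteqP; split=> w //= _; exact: hitting_time_ge0.
have mnone s : 0 <= s -> measurable [set w | M s w <> None].
  by move=> s0; have := measurableC (M_meas None s0).
apply/eqP; rewrite eq_le; apply/andP; split.
- have : survival m j (Num.max 0 u) @[u --> t^'-] --> survival m j (Num.max 0 t).
    exact: cvg_at_left_filter.
  rewrite max_r ?(ltW t0) // => cv.
  have Pf : P [set w | (t%:E <= hitting_time M None w)%E] \is a fin_num.
    by apply: fin_num_measure; exact: measurable_hitting_time_ge.
  rewrite -(fineK Pf) lee_fin; apply: (cvgr_to_ge cv).
  near=> u; have u0 : 0 < u by near: u; exact: nbhs_left_gt.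
  have ut : u < t by near: u; exact: nbhs_left_lt.
  rewrite max_r ?(ltW u0) // -lee_fin fineK // -chain_survival ?(ltW u0) //.
  apply: le_measure; rewrite ?inE.
  + exact: measurable_hitting_time_ge.
  + by apply: mnone; exact: ltW.
  move=> w /=; rewrite leNgt => /negP wt Mu; apply: wt.
  apply: le_lt_trans (_ : u%:E < _)%E; last by rewrite lte_fin.
  by apply: ereal_inf_lbound; exists u => //; split=> //; exact: ltW.
- rewrite -chain_survival ?(ltW t0) //.
  pose N := \bigcup_(n in [set n | rational_time R n < t]) [set w | A n w /\ M t w <> None].
  have mN : measurable N.
    apply: bigcup_measurable => n _; apply: measurableI; [exact: mA|exact/mnone/ltW].
  have PN : P N = 0%E.
    apply: measure_negligible => //.
    rewrite /N bigcup_mkcond; apply: negligible_bigcup => n.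
    case: ifPn => [/set_mem /= nt|_]; last exact: negligible_set0.
    by apply: chain_absorbed; [exact: rational_time_ge0|exact: ltW].
  rewrite -[leRHS]adde0 -PN; apply: le_trans (measureU2 _ _ _) => //; last first.
    exact: measurable_hitting_time_ge.
  apply: le_measure; rewrite ?inE.
  + exact/mnone/ltW.
  + by apply: measurableU => //; exact: measurable_hitting_time_ge.
  move=> w /= Mt; have [wt|wt] := leP t%:E (hitting_time M None w); first by left.
  by right; move/hitting_time_ltP : wt => [n nt An]; exists n.
Unshelve. all: by end_near. Qed.

(** When [phi] is the derivative of a function [Phi] with [Phi 0 = 0], the inner
    integral on the left is [Phi (C w)], or the limit of [Phi] if [C w] is infinite. *)
Lemma hitting_time_tonelli (phi : R -> R) :
  measurable_fun setT phi -> (forall t, 0 <= t -> 0 <= phi t) ->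
  continuous (fun t : R => survival m j (Num.max 0 t)) ->
  (\int[P]_w \int[lebesgue_measure]_(t in `[0%R, +oo[)
     (phi t * (t%:E <= hitting_time M None w)%E%:R)%:E
   = \int[lebesgue_measure]_(t in `[0%R, +oo[) (phi t * survival m j t)%:E)%E.
Proof.
move=> mphi phi0 ca.
pose D : set R := `[0, +oo[%classic.
pose B := [set wt : Omega * R | (wt.2%:E <= hitting_time M None wt.1)%E].
pose f (wt : Omega * R) : \bar R := (\1_D wt.2 * (phi wt.2 * \1_B wt))%:E.
have f0 wt : (0 <= f wt)%E.
  rewrite /f lee_fin !indicE; case: (boolP (wt.2 \in D)) => [|_]; last by rewrite mul0r.
  by rewrite inE /D /= in_itv /= andbT => t0; rewrite !mulr_ge0 ?phi0.
have mD : measurable D by exact: measurable_itv.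
have mf : measurable_fun setT f.
  apply/measurable_EFinP; apply: measurable_funM.
    by apply: measurableT_comp => //; exact: measurable_indic.
  apply: measurable_funM; first exact: measurableT_comp.
  by apply: measurable_indic; exact: measurable_hitting_time_region.
have fE w t : f (w, t) =
    ((fun t => (phi t * (t%:E <= hitting_time M None w)%E%:R)%:E) \_ D) t.
  rewrite /f patchE /= !indicE; case: ifP => tD; rewrite ?mul0r ?mul1r //.
  by congr (_ * (nat_of_bool _)%:R)%:E; apply/idP/idP => [/set_mem|?]; rewrite ?inE.
transitivity (\int[P]_w \int[lebesgue_measure]_t f (w, t))%E.
  apply: eq_integral => w _; rewrite integral_mkcond.
  by apply: eq_integral => t _; rewrite fE.
rewrite fubini_tonelli // [RHS]integral_mkcond; apply: eq_integral => t _.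
under eq_integral do rewrite fE.
rewrite patchE; case: ifP => tD; last first.
  by rewrite integral0_eq // => w _; rewrite patchE tD.
have t0 : 0 <= t by move: tD; rewrite inE /D /= in_itv /= andbT.
under eq_integral do rewrite patchE tD.
have mt := measurable_hitting_time_ge t.
transitivity (\int[P]_w ((phi t)%:E *
    (\1_[set w | (t%:E <= hitting_time M None w)%E] w)%:E))%E.
  apply: eq_integral => w _; rewrite -EFinM indicE; congr (_ * (nat_of_bool _)%:R)%:E.
  by apply/idP/idP => [?|/set_mem //]; rewrite inE.
rewrite ge0_integralZl // ?lee_fin ?phi0 //; last first.
  by apply/measurable_EFinP; exact: measurable_indic.
rewrite integral_indic // setIT EFinM; congr (_ * _)%E.
exact: (hitting_time_tail t0 (ca t)).
Qed.
End chain.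

(** * Mean and variance of a hitting time *)

(** The identity [(X - L)^2 + 2 L X = X^2 + L^2] has nonnegative terms and holds
    also where [X] is infinite, so it can be integrated term by term. *)
Lemma evarianceE d (T : measurableType d) (R : realType) (P : probability T R)
    (X : T -> \bar R) (L S : R) :
  measurable_fun setT X -> (forall w, 0 <= X w)%E ->
  emean P X = L%:E -> (\int[P]_w (X w * X w) = S%:E)%E ->
  evariance P X = (S - L ^+ 2)%:E.
Proof.
move=> mX X0 XL XS.
have L0 : 0 <= L by rewrite -lee_fin -XL; apply: integral_ge0.
have sq0 (x : \bar R) : (0 <= x * x)%E.
  by case: x => [x| |] //=; rewrite ?lee_fin -?expr2 ?sqr_ge0 // mulyy || rewrite mulNyNy.
rewrite /evariance XL.
have e : (\int[P]_w ((X w - L%:E) * (X w - L%:E) + (2 * L)%:E * X w) =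
   \int[P]_w (X w * X w + (L ^+ 2)%:E))%E.
  apply: eq_integral => w _; case: (X w) (X0 w) => [x _| _|//].
  - by rewrite -EFinB -!EFinM -!EFinD; congr EFin; ring.
  - rewrite (_ : +oo - L%:E = +oo)%E // mulyy addye // gt_eqF //.
    by apply: lt_le_trans (ltNyr 0) _; rewrite mule_ge0 // lee_fin mulr_ge0.
have mXL : measurable_fun setT (fun w => X w - L%:E)%E by apply: emeasurable_funB.
move: e; rewrite ge0_integralD //; first last.
- exact: measurable_funeM.
- by move=> w _; rewrite mule_ge0 // lee_fin mulr_ge0.
- exact: emeasurable_funM.
rewrite ge0_integralZl // ?lee_fin ?mulr_ge0 // -/(emean P X) XL.
rewrite ge0_integralD //; last 2 first.
- exact: emeasurable_funM.
- by move=> w _; rewrite lee_fin sqr_ge0.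
rewrite XS integral_cst // [X in (_ = _ + _ * X)%E -> _](_ : _ = 1%E);
  last exact: probability_setT.
rewrite mule1.
case: (\int[P]_w _)%E => [v|//|//]; rewrite -EFinM -!EFinD => -[e]; congr EFin.
move: e; rewrite expr2; lra.
Qed.

Lemma integral_below (R : realType) (c : \bar R) : (0 <= c)%E ->
  (\int[lebesgue_measure]_(t in `[0%R, +oo[) (1 * (t%:E <= c)%E%:R)%:E = c)%E.
Proof.
move=> c0; pose D : set R := `[0, +oo[%classic.
transitivity (\int[lebesgue_measure]_(t in D) (\1_[set t | t%:E <= c]%E t)%:E)%E.
  apply: eq_integral => t _; rewrite mul1r indicE; congr (nat_of_bool _)%:R%:E.
  by apply/idP/idP => [?|/set_mem //]; rewrite inE.
have Dm : measurable D by exact: measurable_itv.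
case: c c0 => [c c0|_|//].
  have -> : [set t | t%:E <= c%:E]%E = `]-oo, c]%classic.
    by apply/seteqP; split=> t; rewrite /= in_itv /= lee_fin.
  rewrite integral_indic //.
  transitivity (lebesgue_measure (`[0, c]%classic : set R)).
    congr (lebesgue_measure _); apply/seteqP; split=> t; rewrite /D /= !in_itv /= andbT.
      by move=> [-> ->].
    by move=> /andP[].
  rewrite lebesgue_measure_itv /= lte_fin; case: ifPn => [_|]; first by rewrite oppr0 adde0.
  by rewrite -leNgt => c0'; congr EFin; apply/eqP; rewrite eq_le c0' andbT -lee_fin.
have -> : [set t | t%:E <= +oo]%E = setT :> set R.
  by apply/seteqP; split=> t //= _; rewrite leey.
rewrite integral_indic // setTI.
by transitivity (lebesgue_measure D) => //; rewrite lebesgue_measure_itv /= ltry.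
Qed.

Lemma integral_linear_below (R : realType) (c : \bar R) : (0 <= c)%E ->
  (\int[lebesgue_measure]_(t in `[0%R, +oo[) (2 * t * (t%:E <= c)%E%:R)%:E = c * c)%E.
Proof.
pose D : set R := `[0, +oo[%classic.
have Dm : measurable D by exact: measurable_itv.
case: c => [c c0|_|//].
- transitivity (\int[lebesgue_measure]_(t in D `&` `[0%R, c]) (2 * t)%:E)%E.
    rewrite integral_mkcondr; apply: eq_integral => t.
    rewrite inE /D /= in_itv /= andbT => t0.
    rewrite patchE; case: ifPn => [/set_mem|/negP].
      by rewrite /= in_itv /= lee_fin => /andP[_ ->]; rewrite mulr1.
    rewrite inE /= in_itv /= t0 /= lee_fin => /negP/negbTE ->.
    by rewrite mulr0.
  have -> : D `&` `[0%R, c] = `[0%R, c]%classic.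
    by apply/setIidPr => t; rewrite /D /= !in_itv /= andbT => /andP[].
  move: c0; rewrite lee_fin le_eqVlt => /predU1P[<-|c0].
    by rewrite set_itv1 integral_set1 mul0e.
  have df x : is_derive (x : R) (1 : R) (fun t => t ^+ 2) (2 * x).
    by apply: is_derive_eq; rewrite /GRing.scale /= mulr1 mulr_natl. 
  rewrite (@continuous_FTC2 _ (fun t => 2 * t) (fun t => t ^+ 2)) //.
  + by rewrite expr0n /= sube0 -EFinM expr2.
  + by apply: continuous_subspaceT => x; exact: mulrl_continuous.
  + split; [by move=> x _; exact: ex_derive| |].
    * by apply: cvg_at_right_filter; exact: exprn_continuous.
    * by apply: cvg_at_left_filter; exact: exprn_continuous.
  + by move=> x _; rewrite derive1E; exact: derive_val.
- rewrite mulyy; apply/eqP; rewrite eq_le leey /=.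
  have e1 : (+oo = \int[lebesgue_measure]_(t in (`[1%R, +oo[ : set R)) 1)%E.
    rewrite integral_cst //= mul1e.
    transitivity (lebesgue_measure (`[1%R, +oo[%classic : set R)) => //.
    by rewrite lebesgue_measure_itv /= ltry.
  rewrite [leLHS]e1.
  have m2 (A : set R) : measurable_fun A (fun t : R => (2 * t * (t%:E <= +oo)%E%:R)%:E).
    apply/measurable_EFinP; under eq_fun do rewrite leey mulr1.
    by apply: measurable_funM.
  apply: (@le_trans _ _ (\int[lebesgue_measure]_(t in (`[1%R, +oo[ : set R))
      (2 * t * (t%:E <= +oo)%E%:R)%:E)%E).
    apply: ge0_le_integral => //; first exact: m2.
    move=> t /=; rewrite in_itv /= andbT => t1; rewrite leey mulr1 lee_fin; lra.
  have m1 : measurable (`[1%R, +oo[%classic : set R) by exact: measurable_itv.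
  apply: (ge0_subset_integral lebesgue_measure m1 Dm (m2 D)).
  + move=> t; rewrite /D /= in_itv /= andbT => t0; rewrite leey mulr1 lee_fin; lra.
  + by move=> t; rewrite /D /= !in_itv /= !andbT; apply: le_trans.
Qed.

(** * The theorem *)

Theorem theorem4p6 (R : realType) (c : nat) (b h_ : nat -> R) (h beta : R)
    (c_ge1 : (1 <= c)%N)
    (b_ge0 : forall j : nat, j != 1%N -> 0 <= b j)
    (b1_lt0 : 0 < - b 1%N)
    (b_sum : (\sum_(j <oo | j != 1%N) (b j)%:E = (- b 1%N)%:E)%E)
    (b0_gt0 : 0 < b 0%N)
    (b2_gt0 : (0%:E < \sum_(2 <= j <oo) (b j)%:E)%E)
    (beta_gt0 : 0 < beta)
    (h_ge0 : forall j : nat, (1 <= j)%N -> 0 <= h_ j)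
    (h_sum : (\sum_(1 <= j <oo) (h_ j)%:E = h%:E)%E)
    (h_gt0 : 0 < h)
    (p : R -> nat -> nat -> R)
    (p_trans : transition_function_of (q_resurrection c b h_ h) p)
    (d : measure_display) (Omega : measurableType d)
    (P : probability Omega R) (j : nat) (M : R -> Omega -> option nat)
    (M_chain : markov_chain P (q_catastrophe c b h_ h beta) M (Some j)) :
  let r := laplace p in
  let C := hitting_time M None in
  let D := 1 - beta * r 0%N 0%N beta in
  [/\ D != 0,
      derivable (r j 0%N) beta 1,
      derivable (r 0%N 0%N) beta 1,
      emean P C = (beta^-1 + r j 0%N beta / D)%:E &
      evariance P C =
        ((beta ^+ 2)^-1 *
           (1 - beta ^+ 2 * (r j 0%N beta) ^+ 2 / D ^+ 2
              - 2 * beta ^+ 2 / D * derive1 (r j 0%N) beta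
              - 2 * beta ^+ 3 * r j 0%N beta / D ^+ 2
                  * derive1 (r 0%N 0%N) beta))%:E].
Proof.
move=> r C D.
have D0 : D != 0.
  rewrite gt_eqF // subr_gt0.
  exact: (beta_laplace_lt1 b_ge0 b1_lt0 b_sum h_ge0 h_sum h_gt0 beta_gt0 p_trans).
have rder i : derivable (r i 0%N) beta 1.
  exact: (resurrection_laplace_derivable b_ge0 b_sum h_ge0 h_sum p_trans).
case: M_chain => m [m_trans M_meas M_right M_start M_fdd].
have fam := catastrophe_backward m_trans.
have ker := catastrophe_killed_rates b_ge0 b_sum h_ge0 h_sum beta_gt0 m_trans.
have survival_cont : continuous (fun t : R => survival m j (Num.max 0 t)).
  exact: (backward_continuous ker fam).
have my := backward_measurable ker fam j.
have y0 t : 0 <= t -> 0 <= survival m j t by exact: (survival_ge0 m_trans).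
have yU := fun l => @backward_laplaceE _ _ _ _ _ ker fam l j.
pose H := survival_transform beta p j.
pose H1 := - beta ^- 2 - (beta^-1 * r j 0%N beta / D)
    + (derive1 (r j 0%N) beta / D
       + beta * r j 0%N beta * derive1 (r 0%N 0%N) beta / D ^+ 2).
have dH : is_derive beta 1 H H1.
  exact: (survival_transform_derive b_ge0 b1_lt0 b_sum h_ge0 h_sum h_gt0 beta_gt0 p_trans).
have UH l : 0 < l -> laplace_fun (survival m j) l = H (l + beta).
  exact: (survival_laplaceE b_ge0 b1_lt0 b_sum h_ge0 h_sum h_gt0 beta_gt0 p_trans m_trans).
(* As [u_j(l) = H(l + beta)], this is minus the difference quotient of [H]. *)
have U1 : (H beta - laplace_fun (survival m j) l) / l @[l --> 0^'+] --> - H1.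
  have := @ex_derive _ _ _ _ _ _ _ dH; have := @derive_val _ _ _ _ _ _ _ dH.
  rewrite /derive /derivable => -> /cvg_dnbhs_at_right /cvgN.
  apply: cvg_trans; apply: near_eq_cvg; near=> l.
  have l0 : 0 < l by near: l; exact: nbhs_right_gt.
  by rewrite UH // -[LHS]/(- (l^-1 * (H (l * 1 + beta) - H beta))) mulr1 -mulrN opprB mulrC.
have U0 : laplace_fun (survival m j) l @[l --> 0^'+] --> H beta.
  have : H beta - (H beta - laplace_fun (survival m j) l) / l * l
      @[l --> 0^'+] --> H beta - (- H1) * 0.
    apply: cvgB; first exact: cvg_cst.
    by apply: cvgM => //; apply: cvg_at_right_filter; exact: cvg_id.
  rewrite mulr0 subr0; apply: cvg_trans; apply: near_eq_cvg; near=> l.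
  have l0 : 0 < l by near: l; exact: nbhs_right_gt.
  by rewrite divfK ?gt_eqF // opprB addrC subrK.
have C0 w : (0 <= C w)%E by exact: hitting_time_ge0.
have mC : measurable_fun setT C by exact: (measurable_hitting_time M_meas M_right).
have EC : emean P C = (H beta)%:E.
  rewrite -(integral_transform_limit my y0 yU U0).
  transitivity (\int[P]_w \int[lebesgue_measure]_(t in `[0%R, +oo[)
    (1 * (t%:E <= C w)%E%:R)%:E)%E.
    by apply: eq_integral => w _; rewrite integral_below.
  rewrite (hitting_time_tonelli m_trans M_meas M_right M_start M_fdd (phi := fun=> 1)) //.
  by apply: eq_integral => t _; rewrite mul1r.
have EC2 : (\int[P]_w (C w * C w) = (2 * - H1)%:E)%E.
  transitivity (\int[P]_w \int[lebesgue_measure]_(t in `[0%R, +oo[)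
    (2 * t * (t%:E <= C w)%E%:R)%:E)%E.
    by apply: eq_integral => w _; rewrite integral_linear_below.
  rewrite (hitting_time_tonelli m_trans M_meas M_right M_start M_fdd
    (phi := fun t => 2 * t)) //.
  - rewrite EFinM -(integral_transform_derivative my y0 yU U0 U1) -ge0_integralZl //.
    + by apply: eq_integral => t _; rewrite -EFinM mulrA.
    + by apply/measurable_EFinP; apply: measurable_funM.
    + by move=> t /=; rewrite in_itv /= andbT => t0; rewrite lee_fin mulr_ge0 ?y0.
  - exact: measurable_funM.
  - by move=> t t0; rewrite mulr_ge0.
split=> //.
- rewrite EC /H /survival_transform -/r -/D; congr EFin; field.
  by rewrite D0 gt_eqF.
- rewrite (evarianceE mC C0 EC EC2) /H /survival_transform -/r -/D /H1; congr EFin.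
  by field; rewrite D0 gt_eqF.
Unshelve. all: by end_near. Qed.
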